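(* Let $(H,\Delta)$ be a compact quantum group and $A$ a unital $C^*$-algebra. Suppose $H$ and $A$ each admit at least one character and that $\delta$ is a free coaction of $H$ on $A$. Then any character of the equivariant join $A\circledast^\delta H$ may be connected via a path of characters to the character $(1\otimes\varepsilon)\circ\mathrm{ev}_1$, i.e. the character sending $f$ with $f(1)=1\otimes h$ to $\varepsilon(h)$, where $\varepsilon$ is the counit of $H$.
   Context: All tensor products of $C^*$-algebras are minimal. A character on a unital $C^*$-algebra is a unital $*$-homomorphism to $\mathbb{C}$; paths of characters are continuous for the topology of pointwise convergence. If the compact quantum group $H$ admits a character, then the counit of its dense Hopf $*$-algebra extends to a character $\varepsilon:H\to\mathbb{C}$, which is the counit in the statement. A coaction $\delta:A\to A\otimes H$ is free if it is injective and the closed linear span of $\{(a\otimes 1)\delta(b):a,b\in A\}$ is $A\otimes H$. The equivariant join is $A \circledast^{\delta} H := \{f\in C([0,1],A\otimes H): f(0)\in\delta(A),\ f(1)\in\mathbb{C}\otimes H\}$, and $\mathrm{ev}_1$ is evaluation at $1$. *)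

(* Defs.v *)
From HB Require Import structures.
From mathcomp Require Import all_boot all_order all_algebra.
From mathcomp Require Import all_classical all_reals all_analysis.
From mathcomp Require Import complex.

Set Implicit Arguments.
Unset Strict Implicit.
Unset Printing Implicit Defensive.
Import Order.TTheory GRing.Theory Num.Theory numFieldNormedType.Exports.

Local Open Scope classical_set_scope.
Local Open Scope ring_scope.

HB.mixin Record hasStar (R : realType) (A : Type) of GRing.Algebra R[i] A := {
  star : A -> A;
  starK : involutive star;
  starD : {morph star : x y / x + y};
  starZ : forall (c : R[i]) x, star (c *: x) = c^* *: star x;
  starM : forall x y, star (x * y) = star y * star x }.

#[short(type="starAlgType")]
HB.structure Definition StarAlgebra (R : realType) :=
  {A of hasStar R A & GRing.Algebra R[i] A}.

HB.instance Definition _ (R : realType) :=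
  hasStar.Build R R[i]^o (@conjCK R[i]) (rmorphD Num.conj) (rmorphM Num.conj)
    (fun x y => etrans (rmorphM Num.conj x y) (mulrC _ _)).

HB.mixin Record isStarMorphism (R : realType) (A B : starAlgType R)
    (f : A -> B) := { rmorph_star : {morph f : x / star x} }.

HB.structure Definition StarMorphism (R : realType) (A B : starAlgType R) :=
  {f of isStarMorphism R A B f & @GRing.LRMorphism R[i] A B *:%R f}.

Notation "{ 'starhom' A -> B }" := (@StarMorphism.type _ A%type B%type)
  (A at level 98, B at level 99) : type_scope.

Notation character A := {starhom A -> (_[i]^o)}.

(* A unital C*-algebra (with 1 <> 0). MathComp-Analysis has no join of its ring
   and normed-module hierarchies, hence the bundling below; [cstar_sort] is the
   carrier on which both families of canonical instances are then declared. *)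
Record cstarAlgType (R : realType) := CStarAlg {
  cstar_space : completeNormedModType R[i];
  cstar_one : cstar_space;
  cstar_mul : cstar_space -> cstar_space -> cstar_space;
  cstar_star : cstar_space -> cstar_space;
  cstar_mulA : associative cstar_mul;
  cstar_mul1l : left_id cstar_one cstar_mul;
  cstar_mul1r : right_id cstar_one cstar_mul;
  cstar_mulDl : left_distributive cstar_mul +%R;
  cstar_mulDr : right_distributive cstar_mul +%R;
  cstar_one_neq0 : cstar_one != 0;
  cstar_scaleAl : forall (c : R[i]) x y,
    c *: cstar_mul x y = cstar_mul (c *: x) y;
  cstar_scaleAr : forall (c : R[i]) x y,
    c *: cstar_mul x y = cstar_mul x (c *: y);
  cstar_starK : involutive cstar_star;
  cstar_starD : {morph cstar_star : x y / x + y};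
  cstar_starZ : forall (c : R[i]) x, cstar_star (c *: x) = c^* *: cstar_star x;
  cstar_starM : forall x y,
    cstar_star (cstar_mul x y) = cstar_mul (cstar_star y) (cstar_star x);
  cstar_normM : forall x y, `|cstar_mul x y| <= `|x| * `|y|;
  cstar_normE : forall x, `|cstar_mul (cstar_star x) x| = `|x| ^+ 2 }.

Definition cstar_sort (R : realType) (A : cstarAlgType R) : Type :=
  cstar_space A.
Coercion cstar_sort : cstarAlgType >-> Sortclass.

Section CStarInstances.
Variables (R : realType) (A : cstarAlgType R).

HB.instance Definition _ := CompleteNormedModule.copy (cstar_sort A) (cstar_space A).
HB.instance Definition _ := GRing.Zmodule_isNzRing.Build (cstar_sort A)
  (@cstar_mulA R A) (@cstar_mul1l R A) (@cstar_mul1r R A)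
  (@cstar_mulDl R A) (@cstar_mulDr R A) (@cstar_one_neq0 R A).
HB.instance Definition _ := GRing.Lmodule_isLalgebra.Build R[i] (cstar_sort A)
  (@cstar_scaleAl R A).
HB.instance Definition _ := GRing.Lalgebra_isAlgebra.Build R[i] (cstar_sort A)
  (@cstar_scaleAr R A).
HB.instance Definition _ := hasStar.Build R (cstar_sort A)
  (@cstar_starK R A) (@cstar_starD R A) (@cstar_starZ R A) (@cstar_starM R A).
End CStarInstances.


Definition lin_span (K : pzRingType) (V : lmodType K) (I : Type) (g : I -> V) :
    set V :=
  [set v | exists s : seq (K * I), v = \sum_(p <- s) p.1 *: g p.2].

Record hilbertType (R : realType) := HilbertSpace {
  hilbert_space :> completeNormedModType R[i];
  inner : {dot hilbert_space for Num.conj};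
  innerE : forall x, inner x x = `|x| ^+ 2 }.

Section HilbertTensor.
Variables (R : realType) (E F G : hilbertType R).

Record is_hilbert_tensor (sigma : E -> F -> G) : Prop := IsHilbertTensor {
  htensorl : forall y, linear (sigma^~ y);
  htensorr : forall x, linear (sigma x);
  htensor_inner : forall x x' y y',
    inner G (sigma x y) (sigma x' y') = inner E x x' * inner F y y';
  htensor_dense : dense (lin_span (fun p : E * F => sigma p.1 p.2)) }.
End HilbertTensor.

Record is_representation (R : realType) (A : cstarAlgType R)
    (E : hilbertType R) (pi : A -> E -> E) : Prop := IsRepresentation {
  rep_linear : forall a, linear (pi a);
  rep_continuous : forall a, continuous (pi a);
  rep_linearl : forall x, linear (pi^~ x);
  rep1 : forall x, pi 1 x = x;
  repM : forall a b x, pi (a * b) x = pi a (pi b x);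
  rep_star : forall a x y, inner E (pi a x) y = inner E x (pi (star a) y) }.

Section MinTensor.
Variables (R : realType) (A B : cstarAlgType R).

(* A list [s] of pairs stands for the element of the algebraic tensor product
   which is the sum of the elementary tensors p.1 (x) p.2 for p in [s].
   [tensor_bound s M]: in every pair of representations (piA, piB), the operator
   (piA (x) piB)(s) on the Hilbert tensor product has norm at most [M]; it is
   enough to test this on the algebraic tensors, which are dense. *)
Definition tensor_bound (s : seq (A * B)) (M : R[i]) : Prop :=
  forall (E F G : hilbertType R) (sigma : E -> F -> G)
    (piA : A -> E -> E) (piB : B -> F -> F),
    is_hilbert_tensor sigma -> is_representation piA -> is_representation piB ->
  forall v : seq (E * F),
    `|\sum_(p <- s) \sum_(q <- v) sigma (piA p.1 q.1) (piB p.2 q.2)|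
      <= M * `|\sum_(q <- v) sigma q.1 q.2|.

(* A completion of the algebraic tensor product *-algebra of A and B for the
   minimal C*-norm, the supremum of |(piA (x) piB)(s)| over all pairs of
   representations. It is unique up to a unique isomorphism. *)
Record minTensor := MinTensor {
  tensor_alg : cstarAlgType R;
  tens : A -> B -> tensor_alg;
  tensl : forall b, linear (tens^~ b);
  tensr : forall a, linear (tens a);
  tens1 : tens 1 1 = 1;
  tensM : forall a a' b b', tens a b * tens a' b' = tens (a * a') (b * b');
  tens_star : forall a b, star (tens a b) = tens (star a) (star b);
  tens_norm_bound : forall s : seq (A * B),
    tensor_bound s `|\sum_(p <- s) tens p.1 p.2|;
  tens_norm_least : forall (s : seq (A * B)) (M : R[i]), 0 <= M ->
    tensor_bound s M -> `|\sum_(p <- s) tens p.1 p.2| <= M;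
  tens_dense : dense (lin_span (fun p : A * B => tens p.1 p.2)) }.
End MinTensor.

Coercion tensor_alg : minTensor >-> cstarAlgType.
Arguments tens {R A B} m _ _.

Section Coactions.
Variables (R : realType) (A H : cstarAlgType R).
Variables (AH : minTensor A H) (HH : minTensor H H).

(* (delta (x) id) o delta = (id (x) Delta) o delta. [assoc] is the canonical
   isomorphism (A (x) H) (x) H -> A (x) (H (x) H), and [delta_id], [id_Delta]
   are delta (x) id and id (x) Delta; as *-homomorphisms are continuous, all three
   are determined by their values on elementary tensors. *)
Definition coassociative (Delta : {starhom H -> HH}) (delta : {starhom A -> AH})
    : Prop :=
  exists (AH_H : minTensor AH H) (A_HH : minTensor A HH)
    (assoc : {starhom AH_H -> A_HH})
    (delta_id : {starhom AH -> AH_H}) (id_Delta : {starhom AH -> A_HH}),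
  [/\ forall a h k, assoc (tens AH_H (tens AH a h) k) =
        tens A_HH a (tens HH h k),
      forall a h, delta_id (tens AH a h) = tens AH_H (delta a) h,
      forall a h, id_Delta (tens AH a h) = tens A_HH a (Delta h) &
      forall a, assoc (delta_id (delta a)) = id_Delta (delta a)].
End Coactions.

Record compactQuantumGroup (R : realType) := CompactQuantumGroup {
  cqg_alg :> cstarAlgType R;
  cqg_tensor : minTensor cqg_alg cqg_alg;
  Delta : {starhom cqg_alg -> cqg_tensor};
  Delta_coassoc : coassociative Delta Delta;
  cancellationl : dense (lin_span (fun p : cqg_alg * cqg_alg =>
    tens cqg_tensor p.1 1 * Delta p.2));
  cancellationr : dense (lin_span (fun p : cqg_alg * cqg_alg =>
    tens cqg_tensor 1 p.1 * Delta p.2)) }.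
Arguments Delta {R} c.

Section QuantumGroup.
Variables (R : realType) (H : compactQuantumGroup R).

Definition unitary_corep (n : nat) (u : 'M[H]_n) : Prop :=
  [/\ forall i j, \sum_k star (u k i) * u k j = (i == j)%:R,
      forall i j, \sum_k u i k * star (u j k) = (i == j)%:R &
      forall i j, Delta H (u i j) = \sum_k tens (cqg_tensor H) (u i k) (u k j)].

(* The dense Hopf *-algebra of H is the linear span of the coefficients of the
   finite-dimensional unitary corepresentations; [is_counit] says that [eps]
   satisfies (eps (x) id) Delta = id = (id (x) eps) Delta on these coefficients,
   hence extends the counit of that Hopf *-algebra. *)
Definition is_counit (eps : character H) : Prop :=
  forall (n : nat) (u : 'M[H]_n), unitary_corep u -> forall i j,
    \sum_k (eps (u i k) : R[i]) *: u k j = u i j /\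
    \sum_k (eps (u k j) : R[i]) *: u i k = u i j.

Variables (A : cstarAlgType R) (AH : minTensor A H).

Definition is_coaction (delta : {starhom A -> AH}) : Prop :=
  coassociative (Delta H) delta /\
  dense (lin_span (fun p : A * H => delta p.1 * tens AH 1 p.2)).

Definition is_free (delta : {starhom A -> AH}) : Prop :=
  injective delta /\
  dense (lin_span (fun p : A * A => tens AH p.1 1 * delta p.2)).
End QuantumGroup.

(* [0, 1] is taken as a type with its subspace topology, so that functions on it
   carry no values outside [0, 1] that characters could detect. *)
Section UnitInterval.
Variable R : realType.

Definition unitInterval : Type := set_type (`[0, 1]%classic : set R).

Fact unitInterval0_subproof : (0 : R) \in (`[0, 1]%classic : set R).
Proof. by rewrite inE /= in_itv /= lexx ler01. Qed.
Fact unitInterval1_subproof : (1 : R) \in (`[0, 1]%classic : set R).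
Proof. by rewrite inE /= in_itv /= lexx ler01. Qed.

Definition I0 : unitInterval := SigSub unitInterval0_subproof.
Definition I1 : unitInterval := SigSub unitInterval1_subproof.

HB.instance Definition _ := Topological.on unitInterval.
HB.instance Definition _ := isPointed.Build unitInterval I0.
End UnitInterval.
Arguments I0 {R}.
Arguments I1 {R}.

Section FunctionAlgebra.
Variables (T : pointedType) (K : pzRingType) (V : algType K).

Fact fct_scalerAl (c : K) (f g : T -> V) : c *: (f * g) = (c *: f) * g.
Proof. by apply/funext => x; apply: scalerAl. Qed.
HB.instance Definition _ :=
  GRing.Lmodule_isLalgebra.Build K (T -> V) fct_scalerAl.

Fact fct_scalerAr (c : K) (f g : T -> V) : c *: (f * g) = f * (c *: g).
Proof. by apply/funext => x; apply: scalerAr. Qed.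
HB.instance Definition _ :=
  GRing.Lalgebra_isAlgebra.Build K (T -> V) fct_scalerAr.
End FunctionAlgebra.

Section CStarContinuity.
Variables (R : realType) (A : cstarAlgType R) (T : topologicalType).

Lemma cstar_mul_continuous (f g : T -> A) :
  continuous f -> continuous g -> continuous (fun x => f x * g x).
Proof.
move=> cf cg x; apply/cvgrPdist_lt => _/posnumP[e]; near (@pinfty_nbhs R[i]) => M.
near=> y => /=; have M0 : 0 < M by [].
have -> : f x * g x - f y * g y = (f x - f y) * g y + f x * (g x - g y).
  by rewrite mulrBl mulrBr [RHS]addrC subrKA.
rewrite [e%:num]splitr (le_lt_trans (ler_normD _ _))// ltrD//.
  rewrite (le_lt_trans (cstar_normM _ _))//.
  rewrite (@le_lt_trans _ _ (`|f x - f y| * M)) ?ler_wpM2l -?ltr_pdivlMr//.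
    by near: y; near: M; apply: cvg_bounded (cg x).
  by near: y; apply: cvgr_dist_lt (cf x) _ _; rewrite // divr_gt0.
rewrite (le_lt_trans (cstar_normM _ _))//.
rewrite (@le_lt_trans _ _ (M * `|g x - g y|)) ?ler_wpM2r -?ltr_pdivlMl//.
by near: y; apply: cvgr_dist_lt (cg x) _ _; rewrite // mulr_gt0 ?invr_gt0.
Unshelve. all: by end_near. Qed.

Lemma cstar_norm_star (x : A) : `|star x| = `|x|.
Proof.
have le (y : A) : `|y| <= `|star y|.
  have [->|y0] := eqVneq y 0; first by rewrite normr0.
  have := cstar_normM (star y) y; rewrite cstar_normE expr2.
  by rewrite ler_pM2r // normr_gt0.
by apply/eqP; rewrite eq_le le -{2}[x]starK le.
Qed.

Lemma cstar_star_continuous (f : T -> A) :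
  continuous f -> continuous (fun x => star (f x)).
Proof.
move=> cf x; apply/cvgrPdist_lt => e e0; near=> y.
have -> : star (f x) - star (f y) = star (f x - f y).
  by rewrite starD -[- f y]scaleN1r starZ rmorphN1 scaleN1r.
by rewrite cstar_norm_star; near: y; apply: cvgr_dist_lt (cf x) _ e0.
Unshelve. all: by end_near. Qed.
End CStarContinuity.

Section EquivariantJoin.
Variables (R : realType) (A H : cstarAlgType R) (AH : minTensor A H).
Variable delta : {starhom A -> AH}.

Definition in_join : {pred unitInterval R -> AH} := fun f =>
  `[< [/\ continuous f, exists a, f I0 = delta a
        & exists h, f I1 = tens AH 1 h] >].

Fact in_join_subalg : GRing.subsemialg_closed in_join.
Proof.
have tensM1 h k : tens AH 1 h * tens AH 1 k = tens AH 1 (h * k).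
  by rewrite tensM mul1r.
have tens10 : tens AH 1 0 = 0.
  by have := tensr AH 1 (-1) 0 0; rewrite scaler0 addr0 scaleN1r addNr.
split.
- apply/asboolP; split; first exact: (@cst_continuous _ AH 1).
    by exists 1; rewrite rmorph1.
  by exists 1; rewrite tens1.
- split.
  + apply/asboolP; split; first exact: (@cst_continuous _ AH 0).
      by exists 0; rewrite linear0.
    by exists 0.
  + move=> f g /asboolP[cf [a fa] [h fh]] /asboolP[cg [b gb] [k gk]].
    apply/asboolP; split.
    * by move=> s; exact: (@continuousD _ _ _ f g s (cf s) (cg s)).
    * by exists (a + b); rewrite -[LHS]/(f I0 + g I0) fa gb linearD.
    * by exists (1 *: h + k); rewrite tensr scale1r -fh -gk.
- move=> c f /asboolP[cf [a fa] [h fh]]; apply/asboolP; split.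
  + move=> s; have := @continuousZr _ _ _ f c s (cf s); exact.
  + by exists (c *: a); rewrite -[LHS]/(c *: f I0) fa linearZ.
  + by exists (c *: h + 0); rewrite tensr tens10 addr0 -fh.
- move=> f g /asboolP[cf [a fa] [h fh]] /asboolP[cg [b gb] [k gk]].
  apply/asboolP; split; first exact: cstar_mul_continuous.
    by exists (a * b); rewrite -[LHS]/(f I0 * g I0) fa gb rmorphM.
  by exists (h * k); rewrite -tensM1 -fh -gk.
Qed.

Record join := Join {
  join_fun :> unitInterval R -> AH;
  join_subproof : join_fun \in in_join }.

HB.instance Definition _ := [isSub for join_fun].
HB.instance Definition _ := [Choice of join by <:].
HB.instance Definition _ :=
  GRing.SubChoice_isSubAlgebra.Build R[i] _ in_join join in_join_subalg.

Fact in_join_star (f : join) : (fun s => star (f s)) \in in_join.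
Proof.
have /asboolP[cf [a fa] [h fh]] := join_subproof f.
apply/asboolP; split; first exact: cstar_star_continuous.
  by exists (star a); rewrite rmorph_star -fa.
exists (star h); have star1 : star 1 = 1 :> A.
  by have := starM (star (1 : A)) 1; rewrite mulr1 starK mulr1.
by rewrite -[in RHS]star1 -tens_star -fh.
Qed.


Lemma join_addE (f g : join) s : (f + g) s = f s + g s.
Proof. by []. Qed.
Lemma join_mulE (f g : join) s : (f * g) s = f s * g s.
Proof. by []. Qed.
Lemma join_scaleE (c : R[i]) (f : join) s : (c *: f) s = c *: f s.
Proof. by rewrite -[join_fun (c *: f)]/(\val (c *: f)) linearZ. Qed.
Definition join_star (f : join) : join := Join (in_join_star f).
Lemma join_starE (f : join) s : join_star f s = star (f s).
Proof. by []. Qed.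
Lemma joinP (f g : join) : (forall s, f s = g s) -> f = g.
Proof. by move=> fg; apply/val_inj/funext. Qed.
Fact join_starK : involutive join_star.
Proof. by move=> f; apply: joinP => s; rewrite !join_starE starK. Qed.
Fact join_starD : {morph join_star : f g / f + g}.
Proof.
by move=> f g; apply: joinP => s; rewrite join_addE !join_starE join_addE starD.
Qed.
Fact join_starZ (c : R[i]) f : join_star (c *: f) = c^* *: join_star f.
Proof. by apply: joinP => s; rewrite join_scaleE !join_starE join_scaleE starZ. Qed.
Fact join_starM f g : join_star (f * g) = join_star g * join_star f.
Proof. by apply: joinP => s; rewrite join_mulE !join_starE join_mulE starM. Qed.
HB.instance Definition _ :=
  hasStar.Build R join join_starK join_starD join_starZ join_starM.
End EquivariantJoin.

(* A path, for pointwise convergence, from [chi0] to [chi1]. *)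
Definition joined_by_path (R : realType) (B : starAlgType R)
    (chi0 chi1 : character B) : Prop :=
  exists gamma : unitInterval R -> character B,
  [/\ forall b, continuous (fun s => gamma s b),
      forall b, gamma I0 b = chi0 b &
      forall b, gamma I1 b = chi1 b].

(* Main.v *)
Require Import Defs.
From HB Require Import structures.
From mathcomp Require Import all_boot all_order all_algebra.
From mathcomp Require Import all_classical all_reals all_analysis.
From mathcomp Require Import complex ring.

Set Implicit Arguments.
Unset Strict Implicit.
Unset Printing Implicit Defensive.
Import Order.TTheory GRing.Theory Num.Theory numFieldNormedType.Exports.
Local Open Scope classical_set_scope.
Local Open Scope ring_scope.

(* A character of the join is [kappa (f t)] for a point [t] of [0, 1] and a
   character [kappa] of A (x) H.  Sliding [t] to 0 leaves [beta = kappa o delta];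
   for a character [e] of H with [e * e = e] one has [(beta (x) e) o delta = beta],
   so the same character is also [(beta (x) e) (f 0)], and sliding back up to 1
   gives [(1 (x) e) (f 1)].  Hence every character, [(1 (x) eps) o ev_1] included,
   is connected to this one, and there is no need to identify [eps] with [e],
   which would require the Peter-Weyl density of the coefficients.  Such an [e]
   comes from the Ellis-Numakura lemma for the compact convolution semigroup of
   characters of H; it is a counit because a unitary idempotent matrix is 1. *)

(** * Complex numbers *)

(** The two ends of the interval do different work. At 0 a character of A (x) H is seen only through
    delta(A), which is what lets [kappa] be exchanged for [beta (x) e]; at 1 only its restriction to
    1 (x) H is seen, which is what lets the arbitrary [beta] be exchanged for a fixed character of
    A. In between, only the point of evaluation moves. The join is handled as a bare star algebra of
    functions, without norm or completeness, so facts about its characters come from solving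
    equations inside it: no character vanishes on an invertible element. Explicit inverses, bump
    functions and a pointwise Neumann series thus take the place of Gelfand theory in locating the
    point [t]. *)

Local Notation Cre := (@complex.Re _).
Local Notation Cim := (@complex.Im _).

Section ComplexNumbers.
Variable R : realType.
Implicit Types z : R[i]^o.

Lemma complex_norm_ge_Re z : (`|Cre z|)%:C%C <= `|z|.
Proof. exact: (normc_ge_Re z). Qed.

Lemma complex_norm_ge_Im z : (`|Cim z|)%:C%C <= `|z|.
Proof.
have := normc_ge_Re (z * 'i%C); rewrite ReiNIm normrN normrM.
by rewrite [X in _ * X](_ : _ = 1) ?mulr1// normc_def /= expr0n expr1n add0r sqrtr1.
Qed.

Lemma complex_norm_le_ReIm z :
  `|z| <= (`|Cre z| + `|Cim z|)%:C%C.
Proof.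
rewrite [in leLHS](complexE z) (le_trans (ler_normD _ _))// normrM.
rewrite !normc_def /= !expr0n /= !addr0 add0r expr1n sqrtr1 mul1r !sqrtr_sqr.
by rewrite rmorphD.
Qed.

Lemma complex_gt0_ex (e : R[i]) : 0 < e -> exists2 d : R, 0 < d & e = d%:C%C.
Proof.
rewrite ltcE /= => /andP[/eqP e0 e1]; exists (Cre e) => //.
by case: e e0 {e1} => a b /= ->.
Qed.

Lemma cvg_complex (T : Type) (F : set_system T) (FF : Filter F)
    (f : T -> R[i]^o) (a b : R) :
  Cre (f x) @[x --> F] --> a -> Cim (f x) @[x --> F] --> b ->
  f @ F --> ((a +i* b)%C : R[i]^o).
Proof.
move=> fa fb; apply/cvgrPdist_lt => _ /complex_gt0_ex[e e0 ->].
near=> x.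
apply: le_lt_trans (complex_norm_le_ReIm _) _.
rewrite ltcR [X in _ < X]splitr ltrD//.
  have -> : Cre ((a +i* b)%C - f x) = a - Cre (f x) by case: (f x).
  by near: x; apply: cvgr_dist_lt fa _ _; rewrite divr_gt0.
have -> : Cim ((a +i* b)%C - f x) = b - Cim (f x) by case: (f x).
by near: x; apply: cvgr_dist_lt fb _ _; rewrite divr_gt0.
Unshelve. all: by end_near. Qed.

Lemma complex_complete (F : set_system R[i]^o) :
  ProperFilter F -> cauchy F -> cvg F.
Proof.
move=> FF /cauchy_ballP F_cauchy.
have aux (g : R[i]^o -> R) : {morph g : x y / x - y} ->
    (forall z, (`|g z|)%:C%C <= `|z|) -> cvg (g @ F).
  move=> gB gle; apply/cauchy_cvgP/cauchy_ballP => e e0.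
  have e0' : 0 < e%:C%C :> R[i] by rewrite ltcR.
  have := F_cauchy _ e0'; rewrite /= !near_simpl /= => H.
  near=> x.
  rewrite -ball_normE /= -ltcR -gB.
  apply: le_lt_trans (gle _) _.
  suff : ball x.1 (e%:C)%C x.2 by rewrite -ball_normE.
  by near: x.
have /cvg_ex[a Ha] := aux _ (raddfB _) complex_norm_ge_Re.
have /cvg_ex[b Hb] := aux _ (raddfB _) complex_norm_ge_Im.
apply/cvg_ex; exists ((a +i* b)%C : R[i]^o).
exact: (@cvg_complex _ F _ id a b Ha Hb).
Unshelve. all: by end_near. Qed.

(* The library already declares [R^o] complete for [R : realType], which blocks a
   second instance on the same head [GRing.regular]; hence this alias. *)
Definition complete_complex : Type := R[i]^o.
HB.instance Definition _ := NormedModule.copy complete_complex R[i]^o.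
HB.instance Definition _ := Uniform_isComplete.Build complete_complex complex_complete.

(** A square rather than a disc: it is the continuous image of a product of two segments, which
    gives its compactness at once. *)
Definition complex_square (M : R) : set R[i]^o :=
  [set z | - M <= Cre z <= M /\ - M <= Cim z <= M].

Lemma compact_complex_square M : compact (complex_square M).
Proof.
pose f (p : R * R) : R[i]^o := (p.1 +i* p.2)%C.
have -> : complex_square M = f @` (`[- M, M] `*` `[- M, M]).
  apply/seteqP; split => [z [h k]|_ [[a b]] /= [ha hb] <-].
    by exists (Cre z, Cim z); rewrite /f/= ?in_itv//; case: (z).
  by split; rewrite /= -?in_itv.
apply: continuous_compact; last by apply: compact_setX; exact: segment_compact.
apply: continuous_subspaceT => -[a b].
apply: cvg_complex; [exact: cvg_fst|exact: cvg_snd].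
Qed.
End ComplexNumbers.

(** * Characters of C*-algebras *)

Section Neumann.
Variables (R : realType) (B : cstarAlgType R).
Implicit Types b x y : B.

Lemma cstar_mul_cvgr b (u : nat -> B) x :
  u @ \oo --> x -> (fun n => b * u n) @ \oo --> b * x.
Proof.
have bc : continuous (fun y : B => b * y).
  by apply: cstar_mul_continuous => y; [exact: cvg_cst|exact: cvg_id].
by move=> ux; exact: cvg_comp ux (bc x).
Qed.

Lemma cstar_exprn_norm b k : `|b ^+ k.+1| <= `|b| ^+ k.+1.
Proof.
elim: k => [|k IH]; first by rewrite !expr1.
rewrite exprS [in leRHS]exprS (le_trans (cstar_normM _ _))//.
exact: ler_wpM2l.
Qed.

(** Such an [x] is a right inverse of [1 - b], written so that a character with value 1 at [b]
    yields the absurd [f x = 1 + f x]. *)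
Lemma neumann b : `|b| < 1 -> exists x, x = 1 + b * x.
Proof.
(* The series starts at exponent 1, so that the norm of [1] never enters the estimate; the missing
   term returns in the witness [1 + x]. *)
move=> b1; pose u k : B := b ^+ k.+1; pose q := Cre `|b|.
have bq : `|b| = q%:C%C by rewrite /q RRe_real// normr_real.
have q0 : 0 <= q by rewrite -(ler0c q) -bq.
have q1 : `|q| < 1 by rewrite ger0_norm// -ltcR -bq.
have : cauchy (series u @ \oo).
  apply/cauchy_seriesP => _ /complex_gt0_ex[e e0 ->].
  have /cauchy_cvgP/cauchy_seriesP/(_ _ e0) := @is_cvg_geometric_series R q _ q1.
  apply: filterS => n; rewrite -ltcR; apply: le_lt_trans.
  apply: le_trans (ler_norm_sum _ _ _) _.
  rewrite ger0_norm ?lecR; last by apply: sumr_ge0 => k _; rewrite mulr_ge0 ?exprn_ge0.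
  rewrite rmorph_sum /=; apply: ler_sum => k _.
  by rewrite (le_trans (cstar_exprn_norm _ _))// bq -rmorphXn /= exprS.
move=> /cauchy_cvgP /cvg_ex[x ux]; exists (1 + x).
have uS : series u n.+1 @[n --> \oo] --> x.
  by rewrite (cvg_shiftS (series u)).
have uE : (fun n => series u n.+1) = (fun n => b + b * series u n).
  apply/funext => n; rewrite /series /= big_nat_recl// mulr_sumr.
  by congr (_ + _).
have : series u n.+1 @[n --> \oo] --> b + b * x.
  by rewrite uE; apply: cvgD; [exact: cvg_cst|exact: cstar_mul_cvgr].
move/(cvg_unique (@norm_hausdorff _ B)) => /(_ _ uS) xE.
by rewrite mulrDr mulr1 xE.
Qed.
End Neumann.

Section Characters.
Variables (R : realType).

(** A predicate on plain functions, since characters arise below as limits, as extensions and as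
    points of a function space; [character_of] bundles them again. *)
Record is_character (B : starAlgType R) (f : B -> R[i]^o) : Prop := IsCharacter {
  charZD : forall (c : R[i]) x y, f (c *: x + y) = c * f x + f y;
  charM : forall x y, f (x * y) = f x * f y;
  char1 : f 1 = 1;
  charS : forall x, f (star x) = (f x)^* }.

Lemma characterP (B : starAlgType R) (f : character B) : is_character f.
Proof.
split=> *; first by rewrite linearD linearZ.
- by rewrite rmorphM.
- by rewrite rmorph1.
- by rewrite rmorph_star.
Qed.

Section OfPredicate.
Variables (B : starAlgType R) (f : B -> R[i]^o) (hf : is_character f).
Definition char_fun of is_character f := f.
Let g := char_fun hf.
HB.instance Definition _ := @GRing.isLinear.Build R[i] B R[i]^o *:%R g
  (charZD hf).
HB.instance Definition _ := @GRing.isMonoidMorphism.Build B R[i]^o g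
  (conj (char1 hf) (charM hf)).
HB.instance Definition _ := @isStarMorphism.Build R B R[i]^o g (charS hf).
Definition character_of : character B := g.
Lemma character_ofE x : character_of x = f x. Proof. by []. Qed.
End OfPredicate.

Lemma is_character_comp (B B' : starAlgType R) (h : {starhom B -> B'})
  (f : B' -> R[i]^o) : is_character f -> is_character (fun x => f (h x)).
Proof.
move=> hf; split=> *; rewrite ?(linearD, linearZ) ?charZD//.
- by rewrite rmorphM charM.
- by rewrite rmorph1 char1.
- by rewrite rmorph_star charS.
Qed.

Section Algebraic.
Variables (B : starAlgType R) (f : B -> R[i]^o) (hf : is_character f).

Lemma char_0 : f 0 = 0.
Proof. by have := charZD hf (-1) 0 0; rewrite scaler0 addr0 mulN1r addNr. Qed.
Lemma char_Z c x : f (c *: x) = c * f x.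
Proof. by have := charZD hf c x 0; rewrite char_0 !addr0. Qed.
Lemma char_D x y : f (x + y) = f x + f y.
Proof. by have := charZD hf 1 x y; rewrite scale1r mul1r. Qed.
Lemma char_B x y : f (x - y) = f x - f y.
Proof. by rewrite char_D -scaleN1r char_Z mulN1r. Qed.
Lemma char_sum (I : Type) (s : seq I) (F : I -> B) :
  f (\sum_(i <- s) F i) = \sum_(i <- s) f (F i).
Proof. by apply: big_morph; [exact: char_D|exact: char_0]. Qed.

End Algebraic.

Section CStar.
Variables (B : cstarAlgType R) (f : B -> R[i]^o) (hf : is_character f).

(** Otherwise [(f x)^-1 *: x] has norm below 1 and value 1 under [f], against [neumann]. Continuity
    of characters is thus automatic. *)
Lemma char_norm_le x : `|f x| <= `|x|.
Proof.
rewrite real_leNgt ?normr_real//; apply/negP => xf.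
have f0 : f x != 0 by rewrite -normr_gt0 (le_lt_trans _ xf).
have [|y yE] := @neumann _ _ ((f x)^-1 *: x).
  by rewrite normrZ normfV mulrC ltr_pdivrMr ?mul1r// normr_gt0.
have /eqP := congr1 f yE; rewrite (char_D hf) (charM hf) (char_Z hf).
rewrite mulVf// mul1r (char1 hf).
by rewrite -subr_eq0 opprD addrCA subrr addr0 oppr_eq0 oner_eq0.
Qed.

Lemma char_continuous : continuous f.
Proof.
move=> x; apply/cvgrPdist_lt => e e0.
have := @cvgr_dist_lt _ B _ (nbhs x) (nbhs_filter x) id x cvg_id _ e0.
by apply: filterS => y; rewrite -(char_B hf); apply: le_lt_trans; exact: char_norm_le.
Qed.
End CStar.
End Characters.

(** * Extension from dense subsets *)

Section Density.
Variable R : realType.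

Lemma dense_approx (V : normedModType R[i]) (S : set V) : dense S ->
  forall (x : V) (e : R[i]), 0 < e -> exists2 y, S y & `|x - y| < e.
Proof.
move=> dS x e e0.
have : nbhs x (ball x e) by exact: nbhsx_ballx.
rewrite nbhsE => [[U [oU Ux] Ue]].
have [|y [Uy Sy]] := dS U _ oU; first by exists x.
by exists y => //; have := Ue _ Uy; rewrite -ball_normE.
Qed.

Lemma dense_eq (V : normedModType R[i]) (S : set V) (h k : V -> R[i]^o) :
  dense S -> continuous h -> continuous k -> (forall y, S y -> h y = k y) ->
  h =1 k.
Proof.
move=> dS ch ck hk x; apply/eqP; rewrite -subr_eq0 -normr_le0.
apply/ler_addgt0Pr => e e0; rewrite add0r.
pose g y := h y - k y.
have cg : continuous g by move=> y; apply: cvgB; [exact: ch|exact: ck].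
have : nbhs x [set y | `|g x - g y| < e].
  exact: (@cvgr_dist_lt _ R[i]^o _ (nbhs x) (nbhs_filter x) g (g x) (cg x) e e0).
rewrite nbhsE => [[U [oU Ux] Ue]].
have [|y [Uy Sy]] := dS U _ oU; first by exists x.
by have := Ue _ Uy; rewrite /= /g (hk _ Sy) subrr subr0 => /ltW.
Qed.

Lemma lipschitz_continuous (V W : normedModType R[i]) (F : V -> W) :
  (forall x y, `|F x - F y| <= `|x - y|) -> continuous F.
Proof.
move=> F1 x; apply/cvgrPdist_lt => e e0.
have := @cvgr_dist_lt _ V _ (nbhs x) (nbhs_filter x) id x cvg_id _ e0.
by apply: filterS => y; apply: le_lt_trans; exact: F1.
Qed.

(** Indexed by [I] instead of a subset of [V], because a tensor is represented by many lists; the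
    Lipschitz hypothesis already contains well-definedness. *)
Lemma lipschitz_extension (V : normedModType R[i]) (I : Type) (S : I -> V)
    (phi : I -> R[i]^o) :
  dense (range S) -> (forall i j, `|phi i - phi j| <= `|S i - S j|) ->
  exists F : V -> R[i]^o,
    (forall i, F (S i) = phi i) /\ (forall x y, `|F x - F y| <= `|x - y|).
Proof.
move=> dS phi1.
have approx x e : 0 < e -> exists i, `|x - S i| < e.
  by move=> /(dense_approx dS x)[_ [i _ <-]]; exists i.
(* This inequality determines the limit of [phi i] as [S i] tends to [x], and yields both
   conclusions: take [x = S i] for the first, and compare through nearby indices for the second. *)
have lim_ex x : exists z : R[i]^o, forall i, `|z - phi i| <= `|x - S i|.
  pose G := filter_from [set e : R[i] | 0 < e] (fun e => [set i | `|x - S i| < e]).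
  have FG : ProperFilter G.
    apply: filter_from_proper; last by move=> e /(approx x).
    apply: filter_from_filter; first by exists 1 => /=.
    move=> d e /= d0 e0.
    have [de|/ltW ed] := real_leP (gtr0_real d0) (gtr0_real e0).
      by exists d => // i /= xi; split=> //; exact: lt_le_trans de.
    by exists e => // i /= xi; split=> //; exact: lt_le_trans ed.
  have : cauchy (phi @ G).
    apply/cauchy_ballP => e e0.
    have Ge : G [set i | `|x - S i| < e / 2].
      by exists (e / 2) => //=; rewrite divr_gt0.
    exists ([set phi i | i in [set i | `|x - S i| < e / 2]],
            [set phi i | i in [set i | `|x - S i| < e / 2]]).
      by split; apply: filterS Ge => i ?; exists i.
    move=> [_ _] /= [[i ie <-] [j je <-]]; rewrite -ball_normE /=.
    rewrite (le_lt_trans (phi1 _ _))// [e]splitr.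
    by rewrite (le_lt_trans (ler_distD x _ _))// ltrD// distrC.
  move=> /(@cauchy_cvgP (complete_complex R)) /cvg_ex[z phiz]; exists z => i.
  apply/ler_addgt0Pr => e e0.
  have e20 : 0 < e / 2 by rewrite divr_gt0.
  have Gz := @cvgr_dist_lt _ R[i]^o _ G _ phi z phiz _ e20.
  have Ge : G [set i | `|x - S i| < e / 2] by exists (e / 2).
  have [j [je jz]] := filter_ex (filterI Ge (Gz _)).
  rewrite (le_trans (ler_distD (phi j) _ _))//.
  rewrite [e]splitr addrA [leRHS]addrC lerD// ?(ltW jz)//.
  rewrite (le_trans (phi1 _ _))// (le_trans (ler_distD x _ _))// addrC.
  by rewrite lerD2r distrC ltW.
have [F FP] := choice lim_ex; exists F; split=> [i|x y].
  by apply/eqP; rewrite -subr_eq0 -normr_le0 (le_trans (FP _ _))// subrr normr0.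
apply/ler_addgt0Pr => e e0.
(* A quarter of [e], because each of the two approximation errors occurs twice in the final sum. *)
have e20 : 0 < e / 2 / 2 by rewrite !divr_gt0.
have [i ie] := approx x _ e20; have [j je] := approx y _ e20.
have -> : F x - F y = (F x - phi i) + (phi i - phi j) + (phi j - F y).
  by rewrite !addrA !subrK.
rewrite (le_trans (ler_normD _ _))// (le_trans (lerD (ler_normD _ _) (lexx _)))//.
rewrite [`|phi j - _|]distrC.
apply: (@le_trans _ _ (`|x - S i| + `|S i - S j| + `|y - S j|)); first by rewrite !lerD.
have -> : S i - S j = (S i - x) + (x - y) + (y - S j) by rewrite !addrA !subrK.
apply: (@le_trans _ _ (`|x - S i| + (`|S i - x| + `|x - y| + `|y - S j|) + `|y - S j|)).
  rewrite lerD2r lerD2l (le_trans (ler_normD _ _))// lerD2r.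
  exact: ler_normD.
rewrite [`|S i - x|]distrC.
set a := `|x - S i|; set b := `|y - S j|; set c := `|x - y|.
have -> : a + (a + c + b) + b = c + ((a + b) + (a + b)).
  by ring.
by rewrite lerD2l [e]splitr lerD// [e / 2]splitr lerD// ltW.
Qed.
End Density.

(** * The one-dimensional Hilbert space *)

Section ComplexHilbert.
Variable R : realType.

Definition complex_inner (x y : complete_complex R) : R[i] :=
  (x : R[i]) * (y : R[i])^*.

Lemma complex_inner_bilinear :
  bilinear_for (GRing.Scale.Law.clone _ _ *%R _)
    (GRing.Scale.Law.clone _ _ (Num.conj \; *%R) _) complex_inner.
Proof.
split=> [y c x x'|x c y y']; rewrite /complex_inner.
  by rewrite -[_ *: x + x']/((c * (x : R[i]) + (x' : R[i]))) mulrDl -mulrA.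
rewrite -[_ *: y + y']/((c * (y : R[i]) + (y' : R[i]))).
by rewrite rmorphD rmorphM mulrDr mulrCA.
Qed.
HB.instance Definition _ := bilinear_isBilinear.Build R[i] (complete_complex R)
  (complete_complex R) R[i] _ _ complex_inner complex_inner_bilinear.
Lemma complex_inner_hermitian (x y : complete_complex R) :
  complex_inner x y = (-1) ^+ false * Num.conj (complex_inner y x).
Proof. by rewrite expr0 mul1r /complex_inner rmorphM/= conjCK mulrC. Qed.
HB.instance Definition _ := isHermitianSesquilinear.Build R[i] (complete_complex R)
  false Num.conj complex_inner complex_inner_hermitian.
Lemma complex_inner_gt0 (x : complete_complex R) : x != 0 -> 0 < complex_inner x x.
Proof. by move=> x0; rewrite /complex_inner -normCK exprn_gt0// normr_gt0. Qed.
HB.instance Definition _ := isDotProduct.Build R[i] (complete_complex R)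
  complex_inner complex_inner_gt0.

Definition complex_hilbert : hilbertType R :=
  @HilbertSpace R (complete_complex R) complex_inner
    (fun x => esym (normCK (x : R[i]))).
End ComplexHilbert.

(** * Product characters on the minimal tensor product *)

Section ProductCharacters.
Variable R : realType.

Lemma conj_continuous : continuous (fun z : R[i]^o => (z^* : R[i]^o)).
Proof.
apply: lipschitz_continuous => x y.
by rewrite -[_^* - _^*]/((x : R[i])^* - (y : R[i])^*) -rmorphB norm_conjC.
Qed.

Lemma lin_span_subset (V : lmodType R[i]) (I : Type) (g : I -> V) (P : set V) :
  P 0 -> (forall x y, P x -> P y -> P (x + y)) ->
  (forall c i, P (c *: g i)) -> lin_span g `<=` P.
Proof.
move=> P0 PD PZ _ [s ->].
by elim/big_ind: _ => // -[c i] _; exact: PZ.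
Qed.

Variables (A B : cstarAlgType R) (AB : minTensor A B).

Lemma tensZl c a b : tens AB (c *: a) b = c *: tens AB a b.
Proof.
have t0 : tens AB 0 b = 0.
  by have := tensl AB b (-1) 0 0; rewrite scaler0 addr0 scaleN1r addNr.
by have := tensl AB b c a 0; rewrite t0 !addr0.
Qed.

Lemma tens_character_eq (F G : AB -> R[i]^o) :
  is_character F -> is_character G ->
  (forall a b, F (tens AB a b) = G (tens AB a b)) -> F =1 G.
Proof.
move=> hF hG FG.
apply: (dense_eq (@tens_dense _ _ _ AB)); try exact: char_continuous.
apply: (@lin_span_subset _ _ _ [set y | F y = G y]).
- by rewrite /= !char_0.
- by move=> x y /= xE yE; rewrite !char_D // xE yE.
- by move=> c [a b] /=; rewrite !char_Z// FG.
Qed.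

Lemma tensZr c a b : tens AB a (c *: b) = c *: tens AB a b.
Proof.
have t0 : tens AB a 0 = 0.
  by have := tensr AB a (-1) 0 0; rewrite scaler0 addr0 scaleN1r addNr.
by have := tensr AB a c b 0; rewrite t0 !addr0.
Qed.

Section Def.
Variables (f : A -> R[i]^o) (g : B -> R[i]^o).

Definition is_product_character (F : AB -> R[i]^o) : Prop :=
  is_character F /\ forall a b, F (tens AB a b) = f a * g b.

Hypotheses (hf : is_character f) (hg : is_character g).

Lemma char_rep (D : cstarAlgType R) (h : D -> R[i]^o) : is_character h ->
  is_representation (E := complex_hilbert R)
    (fun a (z : complete_complex R) => (h a : R[i]) * (z : R[i])).
Proof.
move=> hh; split=> /=.
- move=> a c x y.
  rewrite -[c *: x + y]/(c * (x : R[i]) + (y : R[i])) mulrDr mulrCA.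
  by [].
- move=> a; apply: (@mulrl_continuous R[i]).
- move=> x c a b /=; rewrite charZD// mulrDl -mulrA.
  by [].
- by move=> x; rewrite char1// mul1r.
- by move=> a b x; rewrite charM// mulrA.
- move=> a x y; rewrite /complex_inner (charS hh) rmorphM/= conjCK.
  by rewrite -mulrA mulrCA.
Qed.

Lemma complex_tensor :
  is_hilbert_tensor (E := complex_hilbert R) (F := complex_hilbert R)
    (G := complex_hilbert R)
    (fun x y : complete_complex R => (x : R[i]) * (y : R[i])).
Proof.
split=> /=.
- by move=> y c x x'; rewrite mulrDl -mulrA.
- move=> x c y y'; rewrite -[c *: y + y']/(c * (y : R[i]) + (y' : R[i])).
  by rewrite mulrDr mulrCA.
- move=> x x' y y'; rewrite /complex_inner rmorphM.
  by rewrite mulrACA.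
- move=> U [z Uz] _; exists z; split=> //.
  exists [:: (1, (z, 1))]; rewrite big_seq1 /= mulr1.
  by rewrite scale1r.
Qed.

(** Characters are representations on the complex line, whose Hilbert tensor square is the line
    itself; the minimal norm bounds this pair of representations, tested on the vector [1 (x) 1]. *)
Lemma product_char_bound (s : seq (A * B)) :
  `|\sum_(p <- s) f p.1 * g p.2| <= `|\sum_(p <- s) tens AB p.1 p.2|.
Proof.
have := tens_norm_bound AB s complex_tensor (char_rep hf) (char_rep hg)
  [:: (1 : complete_complex R, 1 : complete_complex R)].
rewrite big_seq1 /= mulr1 normr1 mulr1; apply: le_trans.
by under [X in _ <= `|X|]eq_bigr do rewrite big_seq1 /= !mulr1.
Qed.

Let S (s : seq (A * B)) : AB := \sum_(p <- s) tens AB p.1 p.2.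
Let phi (s : seq (A * B)) : R[i]^o := \sum_(p <- s) f p.1 * g p.2.

Let S_cat s t : S (s ++ t) = S s + S t. Proof. exact: big_cat. Qed.
Let phi_cat s t : phi (s ++ t) = phi s + phi t. Proof. exact: big_cat. Qed.
Let scale (c : R[i]) (s : seq (A * B)) := [seq (c *: p.1, p.2) | p <- s].
Let S_scale c s : S (scale c s) = c *: S s.
Proof. by rewrite /S big_map scaler_sumr; apply: eq_bigr => p _; exact: tensZl. Qed.
Let phi_scale c s : phi (scale c s) = c * phi s.
Proof.
by rewrite /phi big_map mulr_sumr; apply: eq_bigr => p _; rewrite char_Z// mulrA.
Qed.
Let dense_S : dense (range S).
Proof.
move=> U U0 oU; have [x [Ux [s xE]]] := tens_dense (m := AB) U0 oU.
exists x; split=> //.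
exists [seq (p.1 *: p.2.1, p.2.2) | p <- s] => //.
by rewrite /S big_map xE; apply: eq_bigr => p _; exact: tensZl.
Qed.

Lemma is_product_character_ex : exists F, is_product_character F.
Proof.
have [s t|F [FS F1]] := lipschitz_extension (phi := phi) dense_S.
  (* A difference of two lists is again a list, so the bound for one list is the Lipschitz
     condition. *)
  rewrite -[- phi t]mulN1r -[- S t]scaleN1r -phi_scale -S_scale -phi_cat -S_cat.
  exact: product_char_bound.
have cF := lipschitz_continuous F1.
have Ften a b : F (tens AB a b) = f a * g b.
  by have := FS [:: (a, b)]; rewrite /S /phi !big_seq1.
have eqS (h k : AB -> R[i]^o) : continuous h -> continuous k ->
    (forall s, h (S s) = k (S s)) -> h =1 k.
  by move=> ch ck hk; refine (dense_eq dense_S ch ck _) => _ [s _ <-]; exact: hk.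
have contF (u : AB -> AB) : continuous u -> continuous (fun y => F (u y)).
  by move=> cu y; exact: cvg_comp (cu y) (cF (u y)).
have contM (c : R[i]^o) : continuous (fun y => c * F y).
  by move=> y; exact: (@continuousZr _ R[i]^o _ F c y (cF y)).
have idc : continuous (fun y : AB => y) by move=> y; exact: cvg_id.
have cstc (z : AB) : continuous (fun _ : AB => z) by move=> y; exact: cvg_cst.
exists F; split=> //; split.
(* Identities in two variables are extended from the dense range one variable at a time; the first
   pass keeps [S s] fixed. *)
- have ZS c s y : F (c *: S s + y) = c * phi s + F y.
    move: y; apply: eqS => [|y|t].
    + by apply: contF => y; apply: cvgD; [exact: cvg_cst|exact: cvg_id].
    + by apply: cvgD; [exact: cvg_cst|exact: cF].
    + by rewrite -S_scale -S_cat !FS phi_cat phi_scale.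
  move=> c x y; move: x; apply: eqS => [|x|s].
  + apply: contF => x; apply: cvgD; last exact: cvg_cst.
    exact: scaler_continuous.
  + by apply: cvgD; [exact: contM|exact: cvg_cst].
  + by rewrite ZS FS.
- have MS s y : F (S s * y) = phi s * F y.
    move: y; apply: eqS => [||t].
    + by apply: contF; apply: cstar_mul_continuous.
    + exact: contM.
    + have -> : S s * S t = S [seq (p.1 * q.1, p.2 * q.2) | p <- s, q <- t].
        rewrite /S big_allpairs_dep mulr_suml; apply: eq_bigr => p _.
        by rewrite mulr_sumr; apply: eq_bigr => q _; rewrite tensM.
      rewrite !FS /phi big_allpairs_dep mulr_suml; apply: eq_bigr => p _.
      by rewrite mulr_sumr; apply: eq_bigr => q _ /=;
        rewrite (charM hf) (charM hg) mulrACA.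
  move=> x y; move: x; apply: eqS => [||s].
  + by apply: contF; apply: cstar_mul_continuous.
  + by under eq_fun do rewrite mulrC; exact: contM.
  + by rewrite MS FS.
- by rewrite -tens1 Ften (char1 hf) (char1 hg) mulr1.
- apply: eqS => [x|x|s].
  + by move: x; apply: contF; exact: cstar_star_continuous.
  + exact: cvg_comp (cF x) (@conj_continuous _).
  + have -> : star (S s) = S [seq (star p.1, star p.2) | p <- s].
      rewrite /S big_map (big_morph _ (@starD R AB) (_ : _ = 0)).
        by apply: eq_bigr => p _; rewrite tens_star.
      by have := starZ (0 : R[i]) (0 : AB); rewrite !scale0r rmorph0 scale0r.
    rewrite !FS /phi big_map rmorph_sum; apply: eq_bigr => p _.
    by rewrite rmorphM (charS hf) (charS hg).
Qed.

(** Chosen with default value 0, so that it takes no proofs that [f] and [g] are characters.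
    Convolution thereby becomes a total operation on functions, as the section on idempotents
    expects. *)
Definition product_character : AB -> R[i]^o :=
  xget (fun=> 0) is_product_character.

Lemma product_characterP : is_product_character product_character.
Proof. by have [F] := is_product_character_ex; exact: xgetI. Qed.

Lemma product_character_is_character : is_character product_character.
Proof. by case: product_characterP. Qed.

Lemma product_characterE a b : product_character (tens AB a b) = f a * g b.
Proof. by case: product_characterP. Qed.
End Def.
End ProductCharacters.
Arguments product_character {R A B} AB f g _.
Arguments product_character_is_character {R A B} AB {f g} _ _.

(** * Idempotents in compact semigroups *)

Section EllisNumakura.
Variables (T : topologicalType) (S : set T) (op : T -> T -> T).
Hypotheses (hT : hausdorff_space T) (S0 : S !=set0) (cS : compact S).
Hypothesis opS : forall x y, S x -> S y -> S (op x y).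
Hypothesis opA : forall x y z, S x -> S y -> S z ->
  op (op x y) z = op x (op y z).
Hypothesis opc : forall m, S m -> {within S, continuous (op^~ m)}.

Let subsemigroup (K : set T) :=
  [/\ K `<=` S, K !=set0, compact K & forall x y, K x -> K y -> K (op x y)].

(** Zorn's lemma is available for unions of chains, hence the passage to complements in [S]. The
    empty chain gives [S]; for a nonempty one, compactness makes the intersection of the
    subsemigroups nonempty. *)
Lemma minimal_subsemigroup_ex : exists2 M, subsemigroup M &
  forall K, subsemigroup K -> K `<=` M -> K = M.
Proof.
have Sclosed := compact_closed hT cS.
have [|A [PA Amax]] := @Zorn_bigcup T (fun X => subsemigroup (S `\` X)).
  move=> F FP Ftot.
  have [->|F0] := eqVneq F set0; first by rewrite bigcup_set0 setD0; split.
  have /set0P[X0 FX0] := F0.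
  have sub X x : F X -> (S `\` \bigcup_(X in F) X) x -> (S `\` X) x.
    by move=> FX [Sx nx]; split=> // Xx; apply: nx; exists X.
  split.
  - by move=> x [].
  - pose G := filter_from F (fun X => S `\` X).
    have FG : ProperFilter G.
      apply: filter_from_proper; last by move=> X /FP[].
      apply: filter_from_filter; first by exists X0.
      move=> X Y FX FY; have [XY|YX] := Ftot _ _ FX FY.
        by exists Y => // x [Sx nYx]; split; split=> // /XY.
      by exists X => // x [Sx nYx]; split; split=> // /YX.
    have [|p [Sp]] := cS FG; first by exists X0 => // x [].
    rewrite clusterE => clp; exists p; split=> // -[X FX Xp].
    have [_ _ cX _] := FP _ FX.
    have [_ ] : (S `\` X) p; last exact.
    by apply: (compact_closed hT cX); apply: clp; exists X.
  - have -> : S `\` \bigcup_(X in F) X = S `&` \bigcap_(X in F) (S `\` X).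
      apply/seteqP; split=> x.
        by move=> xF; split=> [|X FX]; [case: xF|exact: sub FX xF].
      by move=> [Sx xF]; split=> // -[X FX Xx]; have [] := xF _ FX.
    apply: compact_closedI => //; apply: closed_bigI => X /FP[_ _ cX _].
    exact: compact_closed.
  - move=> x y xF yF; split.
      by case: xF yF => [Sx _] [Sy _]; exact: opS.
    move=> [X FX]; have [_ _ _ XM] := FP _ FX.
    by have [_] := XM _ _ (sub _ _ FX xF) (sub _ _ FX yF).
exists (S `\` A) => // K PK KA.
have [KS _ _ _] := PK.
apply/seteqP; split=> // x [Sx nAx]; apply: contrapT => nKx.
(* If [K] misses a point of the candidate, its complement properly contains the maximal [A]. *)
apply: (Amax (~` K)); last first.
  by rewrite /= setDE setCK; have -> // : S `&` K = K by exact/setIidPr.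
split; last by move=> /(_ _ nKx).
by move=> a Aa Ka; have [] := KA _ Ka.
Qed.

(** For any [m] in a minimal [M], the set [M m] is a compact subsemigroup, so it equals [M] and
    [x m = m] has a solution. The solutions form a compact subsemigroup [N], so [N = M] contains [m]
    itself. *)
Lemma idempotent_ex : exists2 e, S e & op e e = e.
Proof.
have [M [MS [m Mm] cM MM] Mmin] := minimal_subsemigroup_ex.
have Sm := MS _ Mm.
have opmM : {within M, continuous (op^~ m)}.
  exact: continuous_subspaceW MS (opc Sm).
have Mm_M : op^~ m @` M = M.
  apply: Mmin; last by move=> _ [x Mx <-]; exact: MM.
  split.
  - by move=> _ [x Mx <-]; exact/MS/MM.
  - by exists (op m m), m.
  - exact: continuous_compact.
  (* [(x m) (y m) = (x (m y)) m]. *)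
  - move=> _ _ [x Mx <-] [y My <-]; exists (op x (op m y)).
      exact: MM Mx (MM _ _ Mm My).
    have [Sx Sy] := (MS _ Mx, MS _ My).
    by rewrite -opA ?opA//; exact: opS.
pose N := M `&` [set x | op x m = m].
suff NM : N = M by exists m => //; have [] : N m by rewrite NM.
apply: Mmin; last by move=> x [].
split.
- by move=> x [/MS].
- by have [x Mx xm] : (op^~ m @` M) m by [rewrite Mm_M]; exists x.
- apply: (subclosed_compact _ cM); last by move=> x [].
  move=> p Np.
  have Mp : M p.
    apply: (compact_closed hT cM) => B /Np[q [[Mq _] Bq]].
    by exists q.
  split=> //=.
  have FN : ProperFilter (within N (nbhs p)) by exact: within_nbhs_proper.
  (* Along [N] the map [op^~ m] is constantly [m], yet it tends to [op p m]; separation of limits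
     puts [p] in [N]. *)
  have h1 : op^~ m @ within N (nbhs p) --> op p m.
    have /subspace_continuousP/(_ p Mp) := opmM; apply: cvg_trans.
    move=> B hB.
    by apply: (@filterS _ (nbhs p) _ _ _ _ hB) => x h [Mx _]; exact: h.
  have h2 : op^~ m @ within N (nbhs p) --> m.
    move=> B /nbhs_singleton Bm.
    by apply: (@nearW _ (nbhs p)) => x [_ xm]; rewrite /= xm.
  exact: (cvg_unique hT h1 h2).
- move=> x y [Mx xm] [My ym]; split; first exact: MM.
  by rewrite /= opA ?ym//; exact/MS.
Qed.
End EllisNumakura.

(** * Convolution of characters *)

Section Convolution.
Variables (R : realType).

Definition conv_character (A H : cstarAlgType R) (AH : minTensor A H)
    (delta : {starhom A -> AH}) (f : A -> R[i]^o) (g : H -> R[i]^o) : A -> R[i]^o :=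
  fun a => product_character AH f g (delta a).

Lemma conv_is_character (A H : cstarAlgType R) (AH : minTensor A H)
    (delta : {starhom A -> AH}) (f : A -> R[i]^o) (g : H -> R[i]^o) :
  is_character f -> is_character g -> is_character (conv_character delta f g).
Proof.
by move=> hf hg; apply: is_character_comp; exact: product_character_is_character.
Qed.

Lemma star1 (A : starAlgType R) : star 1 = 1 :> A.
Proof. by have := starM (star (1 : A)) 1; rewrite mulr1 starK mulr1. Qed.

Lemma is_character_tensl (A B : cstarAlgType R) (AB : minTensor A B)
    (F : AB -> R[i]^o) :
  is_character F -> is_character (fun a => F (tens AB a 1)).
Proof.
move=> hF; split=> *.
- by rewrite tensl (charZD hF).
- by rewrite -(charM hF) tensM mulr1.
- by rewrite tens1 (char1 hF).
- by rewrite -(charS hF) tens_star star1.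
Qed.

(** Both sides evaluate a triple product character on the twice coacted element: [(f (x) g) (x) k]
    for one bracketing, [f (x) (g (x) k)] for the other. It remains to see that [assoc] carries one
    to the other, which is [E3]. *)
Lemma conv_characterA (A H : cstarAlgType R) (AH : minTensor A H)
    (HH : minTensor H H) (Delta : {starhom H -> HH}) (delta : {starhom A -> AH})
    (f : A -> R[i]^o) (g k : H -> R[i]^o) :
  coassociative Delta delta ->
  is_character f -> is_character g -> is_character k ->
  conv_character delta (conv_character delta f g) k =
  conv_character delta f (conv_character Delta g k).
Proof.
move=> [AH_H [A_HH [assoc [delta_id [id_Delta [Eassoc Edelta EDelta Eco]]]]]].
move=> hf hg hk.
have hfg := product_character_is_character AH hf hg.
have hgk := product_character_is_character HH hg hk.
have hcfg := conv_is_character delta hf hg.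
have hcgk := conv_is_character Delta hg hk.
pose Phi := product_character AH_H (product_character AH f g) k.
pose Psi := product_character A_HH f (product_character HH g k).
have hPhi : is_character Phi by exact: product_character_is_character.
have hPsi : is_character Psi by exact: product_character_is_character.
have hPsia : is_character (fun x => Psi (assoc x)) by exact: is_character_comp.
have E1 : (fun x => Phi (delta_id x)) =1
    product_character AH (conv_character delta f g) k.
  apply: tens_character_eq => [||a h].
  - exact: is_character_comp.
  - exact: (product_character_is_character AH hcfg hk).
  - by rewrite Edelta /Phi !product_characterE.
have E2 : (fun x => Psi (id_Delta x)) =1
    product_character AH f (conv_character Delta g k).
  apply: tens_character_eq => [||a h].
  - exact: is_character_comp.
  - exact: (product_character_is_character AH hf hcgk).
  - by rewrite EDelta /Psi !product_characterE.
(* In an elementary tensor of [AH_H] the left leg is any element of [AH], whereas [assoc] is known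
   only when that leg is elementary. Hence a density argument on [x (x) 1] first, then the
   factorisation [x (x) h = (x (x) 1) (1 (x) h)]. *)
have E3l : (fun x => Psi (assoc (tens AH_H x 1))) =1 product_character AH f g.
  apply: tens_character_eq => [||a h].
  - exact: is_character_tensl hPsia.
  - exact: hfg.
  - by rewrite Eassoc /Psi !product_characterE// (char1 hk) mulr1.
have E3 : Phi =1 (fun x => Psi (assoc x)).
  apply: tens_character_eq => // x h.
  rewrite {1}/Phi product_characterE//.
  have -> : tens AH_H x h = tens AH_H x 1 * tens AH_H 1 h.
    by rewrite tensM mulr1 mul1r.
  rewrite (charM hPsia) E3l -tens1 Eassoc /Psi !product_characterE//.
  by rewrite (char1 hf) (char1 hg) !mul1r.
by apply/funext => a; rewrite /conv_character -E1 -E2 -Eco E3.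
Qed.
End Convolution.

(** * Pointwise convergence and the compact space of characters *)

Section PointwiseTopology.
Variable (U : eqType) (V : topologicalType).
Implicit Types (F : set_system {ptws U -> V}) (f : {ptws U -> V}).

Lemma eval_surj (i : U) : (fun g : U -> V => g i) @` setT = setT.
Proof. by apply/seteqP; split=> // v _; exists (fun=> v). Qed.

Lemma ptws_cvg F f : Filter F ->
  (forall i, (fun g : U -> V => g i) @ F --> f i) -> F --> f.
Proof.
move=> FF Ff; apply/cvg_sup => i; apply/cvg_image; first exact: eval_surj.
move=> W /Ff FW; exists ((fun g : U -> V => g i) @^-1` W) => //.
by apply: image_preimage; exact: eval_surj.
Qed.

Lemma cvg_eval F f i : Filter F -> F --> f -> (fun g : U -> V => g i) @ F --> f i.
Proof.
move=> FF Ff.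
exact: cvg_comp Ff (@proj_continuous U (fun=> V) i f).
Qed.
End PointwiseTopology.

Section CharacterSpace.
Variables (R : realType) (B : cstarAlgType R).

Definition character_set : set {ptws B -> R[i]^o} := [set f | is_character f].

Lemma cvg_eqW (T : Type) (F : set_system T) (FF : ProperFilter F)
    (h k : T -> R[i]^o) (a b : R[i]^o) :
  h @ F --> a -> k @ F --> b -> (\forall x \near F, h x = k x) -> a = b.
Proof.
move=> ha kb hk.
have ka : k @ F --> a by apply: cvg_trans ha; exact: near_eq_cvg.
exact: (@cvg_unique R[i]^o (@norm_hausdorff R[i] R[i]^o) (k @ F) _ a b ka kb).
Qed.

Lemma character_set_closed : closed character_set.
Proof.
move=> p clp.
have FF : ProperFilter (within character_set (nbhs p)) by exact: within_nbhs_proper.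
have ev b : (fun f : {ptws B -> R[i]^o} => f b) @ within character_set (nbhs p)
    --> p b.
  by apply: cvg_eval; exact: cvg_within.
have nearS (P : set {ptws B -> R[i]^o}) : (forall f, is_character f -> P f) ->
    \forall f \near within character_set (nbhs p), P f.
  by move=> SP; apply: (@nearW _ (nbhs p)) => f; exact: SP.
split=> [c x y|x y||x].
- apply: (cvg_eqW FF (ev _)); last by apply: nearS => f hf; exact: charZD.
  apply: cvgD (ev y).
  exact: (@cvgZl_tmp _ R[i]^o _ _ FF c (fun f : {ptws B -> R[i]^o} => f x) _ (ev x)).
- apply: (cvg_eqW FF (ev _)); last by apply: nearS => f hf; exact: charM.
  exact: (@cvgM R[i] _ _ FF _ _ _ _ (ev x) (ev y)).
- apply: (cvg_eqW FF (ev _)); last by apply: nearS => f hf; exact: char1.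
  exact: cvg_cst.
- apply: (cvg_eqW FF (ev _)); last by apply: nearS => f hf; exact: charS.
  exact: cvg_comp (ev x) (@conj_continuous _ (p x)).
Qed.

(** [char_norm_le] confines the characters to a product of squares, compact by Tychonoff. *)
Lemma character_set_compact : compact character_set.
Proof.
have cQ := @tychonoff B (fun=> R[i]^o) (fun b => complex_square (Cre `|b|))
  (fun b => @compact_complex_square R _).
apply: (subclosed_compact character_set_closed cQ).
move=> f hf b /=.
have bE : `|b| = (Cre `|b|)%:C%C by rewrite RRe_real// normr_real.
have fb := char_norm_le hf b; split.
- by rewrite -ler_norml -lecR -bE (le_trans _ fb)//; exact: complex_norm_ge_Re.
- by rewrite -ler_norml -lecR -bE (le_trans _ fb)//; exact: complex_norm_ge_Im.
Qed.

End CharacterSpace.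
Arguments character_set {R} B _.
Arguments character_set_compact {R} B.

Section IdempotentCharacter.
Variable R : realType.

(** Product characters are contractive, so replacing [delta a] by a nearby finite sum of tensors
    costs at most [e / 3], whatever [f]. On that sum the value depends on finitely many evaluations
    of [f]. *)
Lemma conv_character_continuous (A H : cstarAlgType R) (AH : minTensor A H)
    (delta : {starhom A -> AH}) (g : H -> R[i]^o) : is_character g ->
  {within character_set A, continuous
    (fun f : {ptws A -> R[i]^o} => conv_character delta f g : {ptws A -> R[i]^o})}.
Proof.
move=> hg; apply/subspace_continuousP => p Sp.
have FF : Filter (within (character_set A) (nbhs p)) by exact: within_filter.
apply: ptws_cvg => a.
apply/(@cvgrPdist_lt R[i] R[i]^o _ _ (fmap_filter _ FF)) => e e0.
have e30 : 0 < e / 3 by rewrite divr_gt0.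
have [y [s yE] ye] := dense_approx (@tens_dense _ _ _ AH) (delta a) e30.
pose val (f : {ptws A -> R[i]^o}) : R[i]^o :=
  \sum_(q <- s) q.1 * (f q.2.1 * g q.2.2).
have valE f : is_character f -> product_character AH f g y = val f.
  move=> hf; have hfg := product_character_is_character AH hf hg.
  rewrite yE (char_sum hfg); apply: eq_bigr => q _.
  by rewrite (char_Z hfg) product_characterE.
have val_cvg : val @ within (character_set A) (nbhs p) --> val p.
  apply: (@cvg_big R[i]^o _ +%R 0 xpredT (@add_continuous R[i]^o) _ _ s
    (fun q (f : {ptws A -> R[i]^o}) => q.1 * (f q.2.1 * g q.2.2))
    (fun q => q.1 * (p q.2.1 * g q.2.2)) FF) => q _.
  have pF : within (character_set A) (nbhs p) --> p by exact: cvg_within.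
  have qp := @cvg_eval A R[i]^o _ _ q.2.1 FF pF.
  have := @cvgZl_tmp _ R[i]^o _ _ FF (q.1 * g q.2.2) _ _ qp.
  rewrite [_ *: p _]mulrAC -[_ * _ * g _]mulrA.
  by apply: cvg_trans; apply: near_eq_cvg; apply: (@nearW _ (nbhs p)) => f _ /=;
     rewrite mulrA [RHS]mulrAC.
have := @cvgr_dist_lt R[i] R[i]^o _ _ FF val (val p) val_cvg _ e30.
apply: (@filterS _ (nbhs p)) => f fv hf; have {fv} vf := fv hf.
have hfg := product_character_is_character AH hf hg.
have hpg := product_character_is_character AH Sp hg.
change (`|product_character AH p g (delta a) -
  product_character AH f g (delta a)| < e).
have -> : product_character AH p g (delta a) - product_character AH f g (delta a)
   = product_character AH p g (delta a - y) + (val p - val f)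
     - product_character AH f g (delta a - y).
  by rewrite (char_B hpg) (char_B hfg) !valE//; ring.
rewrite (le_lt_trans (ler_normB _ _))//.
apply: (le_lt_trans (lerD (ler_normD _ _) (lexx _))).
have -> : e = e / 3 + e / 3 + e / 3 by field.
by rewrite !ltrD// (le_lt_trans (char_norm_le _ _)).
Qed.

Variable H : compactQuantumGroup R.

Lemma idempotent_character_ex : inhabited (character H) ->
  exists2 e : H -> R[i]^o, is_character e & conv_character (Delta H) e e = e.
Proof.
move=> [chi].
have [||||||e he ee] := @idempotent_ex {ptws H -> R[i]^o} (character_set H)
    (conv_character (Delta H)).
- by apply: hausdorff_product => _; exact: norm_hausdorff.
- by exists (chi : H -> R[i]^o); exact: characterP.
- exact: character_set_compact.
- by move=> f g hf hg; exact: conv_is_character.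
- move=> f g k hf hg hk; apply: conv_characterA => //; exact: Delta_coassoc.
- by move=> g hg; exact: conv_character_continuous.
- by exists e.
Qed.

Lemma idempotent_character_is_counit (eps : character H) :
  conv_character (Delta H) eps eps = eps -> is_counit eps.
Proof.
move=> ee n u [uu1 _ uD]; have heps := characterP eps.
pose U : 'M[R[i]]_n := \matrix_(i, j) (eps (u i j) : R[i]).
pose V : 'M[R[i]]_n := \matrix_(i, j) ((eps (u j i) : R[i])^*).
have VU : V *m U = 1%:M.
  apply/matrixP => i j; rewrite !mxE.
  have := congr1 eps (uu1 i j); rewrite (char_sum heps) => uu.
  transitivity (eps (i == j)%:R : R[i]).
    by rewrite -uu; apply: eq_bigr => k _; rewrite !mxE (charM heps) (charS heps).
  by case: eqP => _; [rewrite (char1 heps)|rewrite (char_0 heps)].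
have UU : U *m U = U.
  apply/matrixP => i j; rewrite !mxE -[in RHS]ee /conv_character uD.
  rewrite (char_sum (product_character_is_character _ heps heps)).
  by apply: eq_bigr => k _; rewrite !mxE product_characterE.
(* [U = (V U) U = V (U U) = V U = 1]. *)
have U1 : U = 1%:M by rewrite -[U]mul1mx -VU -mulmxA UU.
have epsu i j : (eps (u i j) : R[i]) = (i == j)%:R.
  by have := congr1 (fun M : 'M[R[i]]_n => M i j) U1; rewrite !mxE.
move=> i j; split.
- rewrite (bigD1 i)//= epsu eqxx scale1r big1 ?addr0// => k ki.
  by rewrite epsu eq_sym (negbTE ki) scale0r.
- rewrite (bigD1 j)//= epsu eqxx scale1r big1 ?addr0// => k ki.
  by rewrite epsu (negbTE ki) scale0r.
Qed.
End IdempotentCharacter.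

(* With [gamma = beta * e], coassociativity gives [gamma * e = gamma], so
   [beta (x) e] and [gamma (x) e] agree on the dense span of the
   [delta(a)(1 (x) h)]; hence [beta = gamma]. *)
Lemma conv_idempotent (R : realType) (A H : cstarAlgType R) (AH : minTensor A H)
    (HH : minTensor H H) (Delta : {starhom H -> HH}) (delta : {starhom A -> AH})
    (beta : A -> R[i]^o) (e : H -> R[i]^o) :
  coassociative Delta delta ->
  dense (lin_span (fun p : A * H => delta p.1 * tens AH 1 p.2)) ->
  is_character e -> conv_character Delta e e = e -> is_character beta ->
  conv_character delta beta e = beta.
Proof.
move=> co dns he ee hb.
have hg := conv_is_character delta hb he.
set gamma := conv_character delta beta e in hg *.
have gE : conv_character delta gamma e = gamma.
  by rewrite /gamma (conv_characterA co) // ee.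
have hF := product_character_is_character AH hb he.
have hG := product_character_is_character AH hg he.
have FG : product_character AH beta e =1 product_character AH gamma e.
  apply: (dense_eq dns); try exact: char_continuous.
  apply: (@lin_span_subset _ _ _ _
    [set y | product_character AH beta e y = product_character AH gamma e y]).
  - by rewrite /= !char_0.
  - by move=> x y /= xE yE; rewrite (char_D hF) (char_D hG) xE yE.
  - move=> c [a h] /=; rewrite (char_Z hF) (char_Z hG) (charM hF) (charM hG).
    rewrite !product_characterE// (char1 hb) (char1 hg).
    have -> // : product_character AH beta e (delta a) =
              product_character AH gamma e (delta a).
    exact: (esym (congr1 (@^~ a) gE)).
apply/funext => a; have := FG (tens AH a 1).
by rewrite !product_characterE// (char1 he) !mulr1.
Qed.

(** * The unit interval and the retraction of the line onto it *)

Section UnitIntervalTheory.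
Variable R : realType.
Implicit Types s : unitInterval R.

Definition uval s : R := \val s.

Lemma uval_itv s : 0 <= uval s <= 1.
Proof. by case: s => x x01; have := set_mem x01; rewrite /= in_itv. Qed.

Lemma uval_inj : injective uval. Proof. exact: val_inj. Qed.

Lemma uval_continuous : continuous uval.
Proof. exact: initial_continuous. Qed.

Lemma uval_sub_continuous (t : R) : continuous (fun s => uval s - t).
Proof.
move=> s; exact: (@continuousB R R^o _ uval (fun=> t) s (@uval_continuous s)
  (@cst_continuous _ R^o t s)).
Qed.

Lemma unitInterval_continuous (T : topologicalType) (h : T -> unitInterval R) :
  continuous (fun x => uval (h x)) -> continuous h.
Proof. exact: continuous_comp_initial. Qed.

Lemma unitInterval_nbhs s (W : set (unitInterval R)) : nbhs s W ->
  exists2 r : R, 0 < r & forall s', `|uval s - uval s'| < r -> W s'.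
Proof.
move=> [_ /= [[V oV <-] Vs] VW].
have : nbhs (uval s) V by exact: open_nbhs_nbhs.
move=> /nbhs_ballP[r /= r0 rV]; exists r => // s' ss'.
by apply: VW; apply: rV; rewrite -ball_normE.
Qed.

Lemma clamp_subproof (x : R) :
  Num.max 0 (Num.min 1 x) \in (`[0, 1]%classic : set R).
Proof. by rewrite inE /= in_itv /= le_max lexx /= ge_max ler01 ge_min lexx. Qed.

(** Allows paths to be reparametrised by arbitrary real functions. *)
Definition clamp (x : R) : unitInterval R := SigSub (clamp_subproof x).

Lemma uval_clamp x : 0 <= x <= 1 -> uval (clamp x) = x.
Proof. by move=> /andP[x0 x1]; rewrite /uval /= min_r// max_r. Qed.

Lemma clamp_le0 x : x <= 0 -> clamp x = I0.
Proof.
move=> x0; apply: uval_inj; rewrite /uval /= min_r ?(le_trans x0)// max_l//.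
Qed.

Lemma clamp_ge1 x : 1 <= x -> clamp x = I1.
Proof. by move=> x1; apply: uval_inj; rewrite /uval /= min_l// max_r. Qed.

Lemma clamp_continuous : continuous clamp.
Proof.
apply: unitInterval_continuous => x.
have cmin : {for x, continuous ((fun=> 1 : R^o) \min (fun y => y : R^o))}.
  by apply: continuous_min; [exact: cst_continuous|exact: cvg_id].
have := @continuous_max R R (fun=> 0) _ x _ cmin; apply.
exact: cst_continuous.
Qed.
End UnitIntervalTheory.

(** * Characters of the equivariant join *)

Section JoinCharacters.
Variables (R : realType) (A H : cstarAlgType R) (AH : minTensor A H).
Variable delta : {starhom A -> AH}.
Local Notation J := (join delta).

Lemma join_continuous (f : J) : continuous f.
Proof. by have /asboolP[] := join_subproof f. Qed.

Lemma join_at0 (f : J) : exists a, f I0 = delta a.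
Proof. by have /asboolP[] := join_subproof f. Qed.

Lemma join_at1 (f : J) : exists h, f I1 = tens AH 1 h.
Proof. by have /asboolP[] := join_subproof f. Qed.

Definition ramp (g : unitInterval R -> R) (x : AH) (s : unitInterval R) : AH :=
  (g s)%:C%C *: x.

Lemma ramp_continuous (g : unitInterval R -> R) (x : AH) :
  continuous g -> continuous (ramp g x).
Proof.
move=> cg s; rewrite /ramp; apply: (@cvgZr_tmp R[i] AH _ (nbhs s) _
  (fun s => (g s)%:C%C)).
apply: (@cvg_complex R _ (nbhs s) _ (fun s => (g s)%:C%C : R[i]^o)) => /=.
  exact: cg.
exact: cvg_cst.
Qed.

Lemma ramp_in_join (g : unitInterval R -> R) (x : AH) : continuous g ->
  (exists a, (g I0)%:C%C *: x = delta a) ->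
  (exists h, (g I1)%:C%C *: x = tens AH 1 h) -> ramp g x \in in_join delta.
Proof. by move=> cg *; apply/asboolP; split=> //; exact: ramp_continuous. Qed.

Section Scalar.
Variables (g : unitInterval R -> R) (cg : continuous g).
(** The end values of [g] are unrestricted because [delta] and [1 (x) -] are unital. *)
Fact scalar_subproof : ramp g 1 \in in_join delta.
Proof.
apply: ramp_in_join => //.
  by exists ((g I0)%:C%C *: 1); rewrite linearZ rmorph1.
by exists ((g I1)%:C%C *: 1); rewrite tensZr tens1.
Qed.
Definition scalar : J := Join scalar_subproof.
End Scalar.

(* The Neumann series of [b] starts and ends at [1], so it stays in the join
   whether or not the ranges of [delta] and [1 (x) -] are closed. *)
Lemma join_neumann (b : J) : b I0 = 0 -> b I1 = 0 ->
  (forall s, `|b s| <= 1 / 2) -> exists x : J, x = 1 + b * x.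
Proof.
move=> b0 b1 bs.
have h1 : (1 / 2 : R[i]) < 1 by rewrite ltr_pdivrMr// mul1r ltr1n.
have /choice[x xE] s : exists y : AH, y = 1 + b s * y.
  by apply: neumann; exact: le_lt_trans (bs s) h1.
have x_cont : continuous x.
  move=> s; apply/(@cvgrPdist_lt _ AH _ (nbhs s) (nbhs_filter s)) => e e0.
  have K0 : 0 < `|x s| + 1 by rewrite ltr_wpDl.
  (* The factor 2 pays for absorbing [1 / 2 * |x s - x s'|] into the left-hand side; the [+ 1] keeps
     the denominator positive. *)
  have d0 : 0 < e / 2 / (`|x s| + 1) by rewrite !divr_gt0.
  have := @cvgr_dist_lt _ AH _ (nbhs s) (nbhs_filter s) b (b s)
    (@join_continuous b s) _ d0.
  apply: filterS => s' /= bss'.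
  have dE : x s - x s' = b s' * (x s - x s') + (b s - b s') * x s.
    rewrite mulrBr mulrBl [RHS]addrC subrKA [in LHS](xE s) [in LHS](xE s').
    by rewrite opprD addrACA subrr add0r.
  have : `|x s - x s'| <= 1 / 2 * `|x s - x s'| + `|b s - b s'| * `|x s|.
    rewrite {1}dE (le_trans (ler_normD _ _))// lerD// (le_trans (cstar_normM _ _))//.
    exact: ler_wpM2r.
  rewrite -lerBlDl -[X in X - _]mul1r -mulrBl.
  rewrite (_ : 1 - 1 / 2 = 2^-1 :> R[i]); last by field.
  rewrite ler_pdivrMl// => /le_lt_trans; apply.
  rewrite mulrC -ltr_pdivlMr//.
  apply: le_lt_trans (_ : _ <= `|b s - b s'| * (`|x s| + 1)) _.
    by rewrite ler_wpM2l// lerDl.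
  by rewrite -ltr_pdivlMr.
have x_in : x \in in_join delta.
  apply/asboolP; split=> //.
    by exists 1; rewrite xE b0 mul0r addr0 rmorph1.
  by exists 1; rewrite xE b1 mul0r addr0 tens1.
by exists (Join x_in); apply: joinP => s; exact: xE.
Qed.

Variables (chi : J -> R[i]^o) (hchi : is_character chi).

(** Plays in the join the part that the norm bound on characters plays in a C*-algebra. *)
Lemma join_char_neq1 (b : J) : b I0 = 0 -> b I1 = 0 ->
  (forall s, `|b s| <= 1 / 2) -> chi b != 1.
Proof.
move=> b0 b1 bs; apply/eqP => chib.
have [x xE] := join_neumann b0 b1 bs.
have /eqP := congr1 chi xE.
rewrite (char_D hchi) (charM hchi) (char1 hchi) chib mul1r.
by rewrite eq_sym -subr_eq0 addrK oner_eq0.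
Qed.

Definition abscissa : J := scalar (@uval_continuous R).

(** The value [t] is real because [abscissa] is self-adjoint. Were it outside [0, 1], [abscissa - t]
    would be killed by [chi] and yet invertible in the join, with inverse [(s - t)^-1]. *)
Lemma join_char_abscissa_ex : exists s : unitInterval R,
  chi abscissa = (uval s)%:C%C.
Proof.
have star_abs : star abscissa = abscissa.
  apply: joinP => s; rewrite -[LHS]/(star (ramp (@uval R) 1 s)) /ramp starZ star1.
  congr (_ *: _); exact: conjc_real.
have : chi abscissa \is Num.real.
  by rewrite CrealE -(charS hchi) star_abs.
move=> /complex_realP[t tE]; rewrite tE.
have [t01|t01] := boolP (0 <= t <= 1); first by exists (clamp t); rewrite uval_clamp.
exfalso.
have nz s : uval s - t != 0.
  by apply: contra t01; rewrite subr_eq0 => /eqP <-; exact: uval_itv.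
have cd := @uval_sub_continuous R t.
have ci : continuous (fun s => (uval s - t)^-1).
  by move=> s; exact: (@continuousV R _ _ s (nz s) (cd s)).
have E : (abscissa - t%:C%C *: 1) * scalar ci = 1.
  apply: joinP => s; rewrite join_mulE.
  rewrite -[(abscissa - _) s]/((uval s)%:C%C *: 1 - (t%:C%C *: (1 : J)) s).
  rewrite join_scaleE -[(1 : J) s]/(1 : AH) -scalerBl.
  rewrite -[scalar ci s]/(((uval s - t)^-1)%:C%C *: 1) -scalerAl mul1r scalerA.
  by rewrite -rmorphB -rmorphM mulfV// scale1r.
have /eqP := congr1 chi E.
rewrite (charM hchi) (char_B hchi) (char_Z hchi) (char1 hchi) tE mulr1 subrr mul0r.
by rewrite eq_sym oner_eq0.
Qed.

(* With u = (s - t)^2, the bump g = 1 - u / max(u, r^2) vanishes for |s - t| >= r,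
   and (1 - g) is a multiple of u in the join, whence chi(g) = 1. *)
Lemma join_char_local0 (s0 : unitInterval R) (f : J) :
  chi abscissa = (uval s0)%:C%C -> f s0 = 0 -> chi f = 0.
Proof.
move=> chiabs fs0; apply/eqP; apply/negPn/negP => chif.
set lam := chi f in chif; set t := uval s0 in chiabs.
have lam0 : 0 < `|lam| / 2 by rewrite divr_gt0// normr_gt0.
have [r1 r10 r1f] : exists2 r : R, 0 < r &
    forall s, `|t - uval s| < r -> `|f s| < `|lam| / 2.
  apply: unitInterval_nbhs.
  have := @cvgr_dist_lt _ AH _ (nbhs s0) (nbhs_filter s0) f (f s0)
    (@join_continuous f s0) _ lam0.
  by apply: filterS => s; rewrite fs0 sub0r normrN.
have /andP[t0 t1] : 0 <= t <= 1 := uval_itv s0.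
(* The last two bounds make the bump vanish at each end of the interval other than [s0]; [pos]
   replaces a bound that would be 0 by a harmless 1. *)
have [r r0 [rr1 rt0 rt1]] : exists2 r : R, 0 < r &
    [/\ r <= r1, 0 < t -> r <= t & t < 1 -> r <= 1 - t].
  pose pos (x : R) := if 0 < x then x else 1.
  have pos0 x : 0 < pos x by rewrite /pos; case: ifP.
  exists (Num.min r1 (Num.min (pos t) (pos (1 - t)))).
    by rewrite !lt_min r10 !pos0.
  split; first by rewrite ge_min lexx.
  - by move=> tp; rewrite !ge_min /pos tp lexx orbT.
  - by move=> tp; rewrite !ge_min /pos !subr_gt0 tp lexx !orbT.
pose u s : R := (uval s - t) ^+ 2.
pose k s : R := (Num.max (u s) (r ^+ 2))^-1.
pose g s : R := 1 - u s * k s.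
have mx0 s : 0 < Num.max (u s) (r ^+ 2) by rewrite lt_max (exprn_gt0 2 r0) orbT.
have cd := @uval_sub_continuous R t.
have cu : continuous u by move=> s; exact: (@continuousM R _ _ _ s (cd s) (cd s)).
have ck : continuous k.
  move=> s; apply: (@continuousV R _ _ s (lt0r_neq0 (mx0 s))).
  apply: (@continuous_max R _ u (fun=> r ^+ 2) s (cu s)).
  exact: cst_continuous.
have cg : continuous g.
  move=> s; apply: (@continuousB R R^o _ (fun=> 1) _ s); first exact: cst_continuous.
  exact: (@continuousM R _ _ _ s (cu s) (ck s)).
have uk s : 0 <= u s * k s <= 1.
  rewrite /k mulr_ge0 ?sqr_ge0 ?invr_ge0 ?(ltW (mx0 _))//=.
  by rewrite ler_pdivrMr// mul1r le_max lexx.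
have g0 s : r <= `|t - uval s| -> g s = 0.
  move=> rs; have ru : r ^+ 2 <= u s.
    by rewrite /u -[leRHS]real_normK ?num_real// distrC lerXn2r ?nnegrE ?(ltW r0).
  rewrite /g /k max_l// mulfV ?subrr// gt_eqF// (lt_le_trans _ ru)//.
  exact: exprn_gt0.
have g01 s : `|g s| <= 1.
  by have /andP[h1 h2] := uk s; rewrite /g ger0_norm ?subr_ge0// lerBlDr lerDl.
have chig : chi (scalar cg) = 1.
  have E : scalar cg = 1 - (abscissa - t%:C%C *: 1) *
      (abscissa - t%:C%C *: 1) * scalar ck.
    apply: joinP => s.
    have aE : (abscissa - t%:C%C *: 1) s = (uval s - t)%:C%C *: 1.
      rewrite -[LHS]/((uval s)%:C%C *: 1 - (t%:C%C *: (1 : J)) s).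
      by rewrite join_scaleE -[(1 : J) s]/(1 : AH) -scalerBl -rmorphB.
    rewrite -[RHS]/((1 : AH) - (abscissa - t%:C%C *: 1) s * (abscissa - t%:C%C *: 1) s
      * ((k s)%:C%C *: 1)) aE.
    rewrite -[LHS]/((g s)%:C%C *: 1).
    rewrite mulr_algl -scalerAl mulr_algl !scalerA -[X in X - _]scale1r -scalerBl.
    by congr (_ *: _); rewrite /g /u -!rmorphM expr2 -(rmorph1 (real_complex R)) -rmorphB.
  rewrite E (char_B hchi) !(charM hchi) (char_B hchi) (char_Z hchi) (char1 hchi).
  by rewrite chiabs mulr1 subrr !mul0r subr0.
(* Normalised so that [chi b = 1], while [|f s| < |lam| / 2] on the support of the bump makes [b] at
   most [1 / 2]. *)
pose b : J := lam^-1 *: (scalar cg * f).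
have bE s : b s = lam^-1 *: ((g s)%:C%C *: f s).
  by rewrite /b join_scaleE join_mulE -[scalar cg s]/((g s)%:C%C *: 1) -scalerAl mul1r.
have : chi b != 1.
  apply: join_char_neq1.
  (* At an end [b] vanishes through the bump, unless that end is [s0], where it vanishes through
     [f]. *)
  - have [t_gt0|t_le0] := ltP 0 t.
      rewrite bE g0 ?scale0r ?scaler0//.
      by rewrite -[uval I0]/(0 : R) subr0 ger0_norm// rt0.
    have -> : I0 = s0 by apply: uval_inj; apply/eqP; rewrite eq_le t_le0 t0.
    by rewrite bE fs0 !scaler0.
  - have [t_lt1|t_ge1] := ltP t 1.
      rewrite bE g0 ?scale0r ?scaler0//.
      by rewrite -[uval I1]/(1 : R) distrC ger0_norm ?subr_ge0// rt1.
    have -> : I1 = s0 by apply: uval_inj; apply/eqP; rewrite eq_le t_ge1 t1.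
    by rewrite bE fs0 !scaler0.
  - move=> s; rewrite bE normrZ normfV normrZ ler_pdivrMl ?normr_gt0// mulrA mulr1.
    have [rs|rs] := leP r `|t - uval s|.
      by rewrite g0// normr0 mul0r ltW.
    have gs : `|(g s)%:C%C| <= 1 :> R[i].
      by rewrite normc_def /= expr0n addr0 sqrtr_sqr lecR.
    rewrite (le_trans (ler_wpM2r _ gs))// mul1r ltW//.
    by apply: r1f; exact: lt_le_trans rs rr1.
by rewrite /b (char_Z hchi) (charM hchi) chig mul1r mulVf// eqxx.
Qed.

Lemma join_char_local (s0 : unitInterval R) (f g : J) :
  chi abscissa = (uval s0)%:C%C -> f s0 = g s0 -> chi f = chi g.
Proof.
move=> chiabs fg; apply/eqP; rewrite -subr_eq0 -(char_B hchi).
apply/eqP/(join_char_local0 chiabs).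
by rewrite -[LHS]/(f s0 - g s0) fg subrr.
Qed.
End JoinCharacters.

HB.instance Definition _ (R : realType) (B : starAlgType R) :=
  @isStarMorphism.Build R B B idfun (fun _ => erefl).

Section TensorRight.
Variables (R : realType) (A H : cstarAlgType R) (AH : minTensor A H).

Definition tens1r (h : H) : AH := tens AH 1 h.

Fact tens1r_linear : linear tens1r. Proof. exact: tensr. Qed.
Fact tens1r_monoid_morphism : monoid_morphism tens1r.
Proof. by split=> [|h k]; rewrite /tens1r ?tens1// tensM mulr1. Qed.
Fact tens1r_star : {morph tens1r : h / star h}.
Proof. by move=> h; rewrite /tens1r tens_star star1. Qed.
HB.instance Definition _ := @GRing.isLinear.Build R[i] H AH *:%R tens1r
  tens1r_linear.
HB.instance Definition _ := @GRing.isMonoidMorphism.Build H AH tens1r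
  tens1r_monoid_morphism.
HB.instance Definition _ := @isStarMorphism.Build R H AH tens1r tens1r_star.
End TensorRight.

Section Fibers.
Variables (R : realType) (A H : cstarAlgType R) (AH : minTensor A H).
Variable delta : {starhom A -> AH}.
Local Notation J := (join delta).

Lemma eval_is_character (kappa : AH -> R[i]^o) (s : unitInterval R) :
  is_character kappa -> is_character (fun f : J => kappa (f s)).
Proof.
move=> hk; split=> *.
- by rewrite join_addE join_scaleE (charZD hk).
- by rewrite join_mulE (charM hk).
- exact: (char1 hk).
- by rewrite -(charS hk).
Qed.

Variables (chi : J -> R[i]^o) (hchi : is_character chi) (s0 : unitInterval R).
Hypothesis chis0 : chi (abscissa delta) = (uval s0)%:C%C.

(** By [join_char_local], [chi] sees only values at [s0], where [L] agrees with a star homomorphism;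
    so [chi] composed with [L] is a character although [L] is in general not multiplicative. *)
Lemma lift_is_character (B : cstarAlgType R) (iota : {starhom B -> AH})
    (L : B -> J) :
  (forall x, L x s0 = iota x) -> is_character (fun x => chi (L x)).
Proof.
move=> Ls0; split=> [c x y|x y||x].
- rewrite -(charZD hchi); apply: (join_char_local hchi chis0).
  by rewrite join_addE join_scaleE !Ls0 linearP.
- rewrite -(charM hchi); apply: (join_char_local hchi chis0).
  by rewrite join_mulE !Ls0 rmorphM.
- rewrite -(char1 hchi); apply: (join_char_local hchi chis0).
  by rewrite Ls0 rmorph1.
- rewrite -(charS hchi); apply: (join_char_local hchi chis0).
  by rewrite -[RHS]/(star (L x s0)) !Ls0 rmorph_star.
Qed.

Variables (alpha0 : A -> R[i]^o) (e : H -> R[i]^o).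
Hypotheses (halpha0 : is_character alpha0) (he : is_character e).
Hypothesis conv_e : forall alpha, is_character alpha ->
  conv_character delta alpha e = alpha.

(** The values at [s0] range over delta(A), over 1 (x) H or over all of A (x) H, according as [s0]
    is 0, 1 or interior. At the ends [chi] gives a character of A or H only, which a product
    character extends to A (x) H. *)
Lemma join_char_fiber : exists2 kappa : AH -> R[i]^o, is_character kappa &
  forall f, chi f = kappa (f s0).
Proof.
have /andP[t0 t1] := uval_itv s0; set t := uval s0 in t0 t1.
have c0 := @uval_continuous R.
have cB : continuous (fun s : unitInterval R => 1 - uval s).
  move=> s; exact: (@continuousB R R^o _ (fun=> 1) _ s
    (@cst_continuous _ R^o 1 s) (c0 s)).
have [t_eq0|t_neq0] := eqVneq t 0.
  have s0E : s0 = I0 by exact: uval_inj.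
  have L_in a : ramp (fun s : unitInterval R => 1 - uval s) (delta a) \in in_join delta.
    apply: ramp_in_join => //.
      by exists a; rewrite -[uval I0]/(0 : R) subr0 scale1r.
    (* Zero is spelled [0 *: 0] so that [tensZr] shows the tensor to vanish. *)
    by exists (0 *: 0); rewrite tensZr -[uval I1]/(1 : R) subrr rmorph0 !scale0r.
  pose L a : J := Join (L_in a).
  have Ls0 a : L a s0 = delta a.
    by rewrite /L /= /ramp -/t t_eq0 subr0 scale1r.
  have hL := lift_is_character Ls0.
  (* Pulled back along [delta], this extension returns the character of A, by [conv_e]. *)
  exists (product_character AH (fun a => chi (L a)) e).
    exact: product_character_is_character.
  move=> f; have [a fa] := join_at0 f; rewrite s0E fa.
  rewrite -[RHS]/(conv_character delta (fun a => chi (L a)) e a) conv_e//.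
  by apply: (join_char_local hchi chis0); rewrite Ls0 s0E.
have [t_eq1|t_neq1] := eqVneq t 1.
  have s0E : s0 = I1 by exact: uval_inj.
  have L_in h : ramp (@uval R) (tens1r AH h) \in in_join delta.
    apply: ramp_in_join => //.
      by exists 0; rewrite -[uval I0]/(0 : R) rmorph0 scale0r linear0.
    by exists h; rewrite -[uval I1]/(1 : R) scale1r.
  pose L h : J := Join (L_in h).
  have Ls0 h : L h s0 = tens1r AH h.
    by rewrite /L /= /ramp -/t t_eq1 scale1r.
  have hL := lift_is_character Ls0.
  exists (product_character AH alpha0 (fun h => chi (L h))).
    exact: product_character_is_character.
  move=> f; have [h fh] := join_at1 f; rewrite s0E fh product_characterE//.
  rewrite (char1 halpha0) mul1r.
  by apply: (join_char_local hchi chis0); rewrite Ls0 s0E.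
have tt0 : t * (1 - t) != 0.
  by rewrite mulf_neq0// subr_eq0 eq_sym.
(* A parabola vanishing at both ends and scaled to be 1 at [s0], so that every [x] is the value at
   [s0] of an element of the join. *)
have cp : continuous (fun s : unitInterval R =>
    (t * (1 - t))^-1 * (uval s * (1 - uval s))).
  move=> s; apply: (@continuousM R _ (fun=> (t * (1 - t))^-1) _ s).
    exact: cst_continuous.
  exact: (@continuousM R _ _ _ s (c0 s) (cB s)).
have L_in x : ramp (fun s : unitInterval R =>
    (t * (1 - t))^-1 * (uval s * (1 - uval s))) x \in in_join delta.
  apply: ramp_in_join => //.
    by exists 0; rewrite -[uval I0]/(0 : R) mul0r mulr0 rmorph0 scale0r linear0.
  by exists (0 *: 0); rewrite tensZr -[uval I1]/(1 : R) subrr !mulr0 rmorph0 !scale0r.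
pose L x : J := Join (L_in x).
have Ls0 x : L x s0 = idfun x.
  by rewrite /L /= /ramp -/t mulVf// scale1r.
exists (fun x => chi (L x)); first exact: lift_is_character Ls0.
by move=> f; apply: (join_char_local hchi chis0); rewrite Ls0.
Qed.
End Fibers.

(** * Paths of characters *)

Section Paths.
Variables (R : realType) (B : starAlgType R).
Implicit Types f g h : B -> R[i]^o.

Definition character_path f g : Prop := exists gamma : unitInterval R -> B -> R[i]^o,
  [/\ forall s, is_character (gamma s), forall b, continuous (gamma^~ b),
      gamma I0 = f & gamma I1 = g].

Lemma joined_by_pathP (f g : character B) : character_path f g -> joined_by_path f g.
Proof.
move=> [gamma [hgamma cgamma g0 g1]].
exists (fun s => character_of (hgamma s)); split=> b.
- exact: cgamma.
- by rewrite character_ofE g0.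
- by rewrite character_ofE g1.
Qed.

Lemma clamp_comp_continuous (u : unitInterval R -> R)
    (gamma : unitInterval R -> R[i]^o) :
  continuous u -> continuous gamma -> continuous (fun s => gamma (clamp (u s))).
Proof.
move=> cu cgamma s.
have cs := @continuous_comp _ _ _ u (@clamp R) s (cu s) (@clamp_continuous R (u s)).
exact: (@continuous_comp _ _ _ (@clamp R \o u) gamma s cs (cgamma _)).
Qed.

Lemma character_path_sym f g : character_path f g -> character_path g f.
Proof.
move=> [gamma [hgamma cgamma g0 g1]].
exists (fun s => gamma (clamp (1 - uval s))); split=> [s|b||].
- exact: hgamma.
- apply: (@clamp_comp_continuous (fun s => 1 - uval s) (gamma^~ b)) => // s.
  exact: (@continuousB R R^o _ (fun=> 1) _ s
    (@cst_continuous _ R^o 1 s) (@uval_continuous R s)).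
- by rewrite -[uval I0]/(0 : R) subr0 clamp_ge1.
- by rewrite -[uval I1]/(1 : R) subrr clamp_le0.
Qed.

(* As the clamped halves of the concatenation are constant outside their own
   half of the interval, it is a sum of continuous functions. *)
Lemma character_path_trans f g h :
  character_path f g -> character_path g h -> character_path f h.
Proof.
move=> [ga [hga cga ga0 ga1]] [gb [hgb cgb gb0 gb1]].
(* On each half of the interval the idle path rests at the common end point [g], which is
   subtracted. *)
pose gamma s b := ga (clamp (2 * uval s)) b + gb (clamp (2 * uval s - 1)) b - g b.
have gamma_l s : 2 * uval s <= 1 -> gamma s = ga (clamp (2 * uval s)).
  move=> s1; apply/funext => b; rewrite /gamma [clamp (_ - 1)]clamp_le0 ?subr_le0//.
  by rewrite gb0 addrK.
have gamma_r s : 1 <= 2 * uval s -> gamma s = gb (clamp (2 * uval s - 1)).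
  move=> s1; apply/funext => b; rewrite /gamma [clamp (2 * _)]clamp_ge1//.
  by rewrite ga1 addrAC subrr add0r.
exists gamma; split=> [s|b||].
- have [s1|/ltW s1] := leP (2 * uval s) 1; first by rewrite gamma_l.
  by rewrite gamma_r.
- have c2 : continuous (fun s : unitInterval R => 2 * uval s).
    move=> s; apply: (@continuousM R _ (fun=> 2) _ s); first exact: cst_continuous.
    exact: uval_continuous.
  have c21 : continuous (fun s : unitInterval R => 2 * uval s - 1).
    move=> s; exact: (@continuousB R R^o _ _ (fun=> 1) s (c2 s)
      (@cst_continuous _ R^o 1 s)).
  have ca := clamp_comp_continuous c2 (cga b).
  have cb := clamp_comp_continuous c21 (cgb b).
  move=> s; apply: (@continuousB R[i] R[i]^o _ _ (fun=> g b) s); last first.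
    exact: cst_continuous.
  exact: (@continuousD R[i] R[i]^o _ _ _ s (ca s) (cb s)).
- by rewrite gamma_l -[uval I0]/(0 : R) mulr0 ?ler01// clamp_le0.
- have e21 : 2 * uval I1 - 1 = 1 :> R by rewrite -[uval I1]/(1 : R); ring.
  by rewrite gamma_r ?e21 ?clamp_ge1// -[uval I1]/(1 : R) mulr1 ler1n.
Qed.
End Paths.

(** The point of evaluation moves linearly as [s * s'] while [kappa] stays fixed; continuity is that
    of [f] and of [kappa]. *)
Lemma character_path_eval (R : realType) (A H : cstarAlgType R)
    (AH : minTensor A H) (delta : {starhom A -> AH}) (kappa : AH -> R[i]^o)
    (s : unitInterval R) : is_character kappa ->
  character_path (fun f : join delta => kappa (f I0)) (fun f => kappa (f s)).
Proof.
move=> hk; have cs : continuous (fun s' : unitInterval R => uval s * uval s').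
  move=> s'; apply: (@continuousM R _ (fun=> uval s) _ s').
    exact: cst_continuous.
  exact: uval_continuous.
exists (fun s' (f : join delta) => kappa (f (clamp (uval s * uval s')))).
split=> [s'|f||].
- exact: eval_is_character.
- apply: (clamp_comp_continuous (gamma := fun s' => kappa (f s'))) => // s'.
  exact: (@continuous_comp _ _ _ f kappa s' (@join_continuous _ _ _ _ _ f s')
    (char_continuous hk (x := f s'))).
- by rewrite -[uval I0]/(0 : R) mulr0 clamp_le0.
- apply/funext => f; congr (kappa (f _)); apply: uval_inj.
  by rewrite -[uval I1]/(1 : R) mulr1 uval_clamp// uval_itv.
Qed.

Theorem corollary4p9 (R : realType) (H : compactQuantumGroup R)
    (A : cstarAlgType R) (AH : minTensor A H) (delta : {starhom A -> AH})
    (hH : inhabited (character H)) (hA : inhabited (character A))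
    (hdelta : is_coaction delta) (hfree : is_free delta) :
  (exists eps : character H, is_counit eps) /\
  forall eps : character H, is_counit eps ->
  exists eps1 : character (join delta),
    (forall (f : join delta) (h : H), f I1 = tens AH 1 h -> eps1 f = eps h) /\
    forall chi : character (join delta), joined_by_path chi eps1.
Proof.
have [e he ee] := idempotent_character_ex hH.
split.
  by exists (character_of he); exact: idempotent_character_is_counit.
move=> eps _; have [[a0] [co dns]] := (hA, hdelta).
have ha0 := characterP a0.
have absorb alpha : is_character alpha -> conv_character delta alpha e = alpha.
  exact: (conv_idempotent co dns he ee).
have hat1 (beta : A -> R[i]^o) (g : H -> R[i]^o) (f : join delta) h :
    is_character beta -> is_character g -> f I1 = tens AH 1 h ->
    product_character AH beta g (f I1) = g h.
  by move=> hb hg ->; rewrite product_characterE// (char1 hb) mul1r.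
(* By [hat1] the choice of [a0] is invisible on the values at 1. *)
pose at1 (g : H -> R[i]^o) (f : join delta) := product_character AH a0 g (f I1).
have path_e (chi : join delta -> R[i]^o) :
    is_character chi -> character_path chi (at1 e).
  move=> hchi; have [s chis] := join_char_abscissa_ex hchi.
  have [kappa hk chik] := join_char_fiber hchi chis ha0 he absorb.
  have hb : is_character (fun a => kappa (delta a)) by exact: is_character_comp.
  have hbe := product_character_is_character AH hb he.
  apply: (@character_path_trans R (join delta) chi
    (fun f : join delta => kappa (f I0)) (at1 e)).
    apply: character_path_sym.
    have := character_path_eval delta s hk.
    by rewrite (_ : (fun f : join delta => kappa (f s)) = chi)//; apply/funext.
  (* The way back up uses [beta (x) e] instead of [kappa]: the two agree on delta(A) by [absorb],
     and at 1 [beta] gives way to [a0]. *)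
  have := character_path_eval delta I1 hbe.
  rewrite (_ : (fun f : join delta => _ (f I0)) = (fun f => kappa (f I0))).
    rewrite (_ : (fun f : join delta => _ (f I1)) = at1 e)//.
    apply/funext => f; have [h fh] := join_at1 f.
    by rewrite /at1 !(hat1 _ _ f h).
  apply/funext => f; have [a ->] := join_at0 f.
  exact: (congr1 (@^~ a) (absorb _ hb)).
have heps1 : is_character (at1 eps).
  apply: eval_is_character; apply: product_character_is_character => //.
  exact: characterP.
exists (character_of heps1); split=> [f h fh|chi].
  by rewrite character_ofE /at1 (hat1 _ _ f h)//; exact: characterP.
apply: joined_by_pathP; apply: character_path_trans (path_e _ (characterP chi)) _.
by apply: character_path_sym; exact: path_e.
Qed.
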